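(* The space $\mathcal{X}$ of oriented surfaces with positive intrinsic curvature in $S^3$ retracts onto $S^3$: there is a continuous map $r:\mathcal{X}\to S^3$ such that $r(S_p)=p$ for every $p\in S^3$, where $S_p$ denotes the oriented great sphere $\{x\in S^3:\langle x,p\rangle=0\}$ with unit normal $p$, and $S^3$ is regarded as a subspace of $\mathcal{X}$ via $p\mapsto S_p$.
   Context: $S^3$ is the unit sphere in $\mathbb{R}^4$ with its standard metric. $\mathcal{X}$ is the space of smooth immersions $x:S^2\to S^3$ whose induced metric has strictly positive Gauss curvature, modulo composition with orientation-preserving diffeomorphisms of $S^2$, with the quotient of the $C^\infty$ topology. The orientation of $S^2$ together with that of $S^3$ determines the unit normal of each such surface, so that the elements of $\mathcal{X}$ are oriented surfaces and the same surface with its two opposite orientations gives two elements of $\mathcal{X}$ (compact oriented surfaces with positive intrinsic curvature are spheres). The subspace of oriented great (totally geodesic) spheres is identified with $S^3$ by associating to an oriented great sphere its constant unit normal vector in $\mathbb{R}^4$. *)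

(* Defs.v *)
From HB Require Import structures.
From mathcomp Require Import all_boot all_order all_algebra ring.
From mathcomp Require Import all_classical all_reals all_analysis.
Set Implicit Arguments.
Unset Strict Implicit.
Unset Printing Implicit Defensive.
Import Order.TTheory GRing.Theory Num.Theory.
Import numFieldNormedType.Exports.
Local Open Scope classical_set_scope.
Local Open Scope ring_scope.

Section Euclidean.
Variable R : realType.

Definition dot n (u v : 'rV[R]_n) : R := \sum_i u 0 i * v 0 i.

Definition sphere n : set 'rV[R]_n.+1 := [set x | dot x x = 1].

Definition frame_det n (s : n.-tuple 'rV[R]_n) : R := \det (\matrix_i tnth s i).

Definition partial (W : normedModType R) (i : 'I_2) (f : 'rV[R]_2 -> W) :
  'rV[R]_2 -> W := 'D_(delta_mx 0 i) f.

(* iterated partial derivative, the head of w being the outermost one *)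
Definition partials (W : normedModType R) (w : seq 'I_2) (f : 'rV[R]_2 -> W) :
  'rV[R]_2 -> W := foldr (@partial W) f w.

(* Equivalent to being C^oo: if all iterated partial derivatives exist and are
   differentiable, then they are all continuous, and conversely. *)
Definition smooth (W : normedModType R) (f : 'rV[R]_2 -> W) :=
  forall w u, differentiable (partials w f) u.

End Euclidean.
Arguments sphere : clear implicits.

Section Curvature.
Variable R : realType.

Definition metric n (f : 'rV[R]_2 -> 'rV[R]_n) (u : 'rV[R]_2) : 'M[R]_2 :=
  \matrix_(i, j) dot (partial i f u) (partial j f u).

Variable g : 'rV[R]_2 -> 'M[R]_2.

Definition christoffel (k i j : 'I_2) (u : 'rV[R]_2) : R :=
  2^-1 * \sum_l invmx (g u) k l *
    (partial i (fun v => g v j l) u + partial j (fun v => g v i l) u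
     - partial l (fun v => g v i j) u).

(* l-th component of R(e_i, e_j) e_k, for the Levi-Civita connection of g and
   R(X, Y) = [nabla_X, nabla_Y] - nabla_[X, Y] *)
Definition riemann (l i j k : 'I_2) (u : 'rV[R]_2) : R :=
  partial i (christoffel l j k) u - partial j (christoffel l i k) u
  + \sum_m (christoffel m j k u * christoffel l i m u
            - christoffel m i k u * christoffel l j m u).

(* <R(e_0, e_1) e_1, e_0> / (|e_0|^2 |e_1|^2 - <e_0, e_1>^2); normalised so that
   the round metric has curvature 1, see round_curvature *)
Definition gauss_curvature (u : 'rV[R]_2) : R :=
  (\sum_l riemann l 0 1 1 u * g u l 0) / \det (g u).

End Curvature.

Section Calculus.
Variable R : realType.

(* Inverse stereographic projections, from the pole (0, 0, - (-1)^b). The sign in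
   the second coordinate makes both positively oriented for the outward normal. *)
Definition stereo_pt (b : bool) (u : 'rV[R]_2) : 'rV[R]_3 :=
  let c := 1 + dot u u in
  \row_j [:: 2 * u 0 0 / c; (-1) ^+ b * (2 * u 0 1 / c);
             (-1) ^+ b * ((1 - dot u u) / c)]`_j.

(* The rows are - p i, - p j, - p k (quaternion products, with
   p = a + b i + c j + d k). For |p| = 1 they form an orthonormal basis of p^perp
   which, followed by p, is a positively oriented basis of R^4. *)
Definition perp_frame (p : 'rV[R]_4) : 'M[R]_(3, 4) :=
  let: (a, b, c, d) := (p 0 0, p 0 1, p 0 2%:R, p 0 3%:R) in
  \matrix_(i, j)
    (nth [::] [:: [:: b; - a; - d; c]; [:: c; d; - a; - b]; [:: d; - c; b; - a]]
       i)`_j.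

Lemma onep_dot_gt0 n (u : 'rV[R]_n) : 0 < 1 + dot u u.
Proof.
by rewrite ltr_pwDl// sumr_ge0// => i _; rewrite -expr2 sqr_ge0.
Qed.

Lemma onep_dot_neq0 n (u : 'rV[R]_n) : 1 + dot u u != 0.
Proof. by rewrite gt_eqF// onep_dot_gt0. Qed.

Lemma sum2E (V : nmodType) (F : 'I_2 -> V) : \sum_i F i = F 0 + F 1.
Proof.
by rewrite !big_ord_recl big_ord0 addr0; congr (F _ + F _); apply: val_inj.
Qed.

Lemma sum3E (V : nmodType) (F : 'I_3 -> V) : \sum_i F i = F 0 + F 1 + F 2%:R.
Proof.
rewrite !big_ord_recl big_ord0 addr0 addrA.
by congr (F _ + F _ + F _); apply: val_inj.
Qed.

Lemma sum4E (V : nmodType) (F : 'I_4 -> V) :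
  \sum_i F i = F 0 + F 1 + F 2%:R + F 3%:R.
Proof.
rewrite !big_ord_recl big_ord0 addr0 !addrA.
by congr (F _ + F _ + F _ + F _); apply: val_inj.
Qed.

Lemma dot2E (u v : 'rV[R]_2) : dot u v = u 0 0 * v 0 0 + u 0 1 * v 0 1.
Proof. exact: sum2E. Qed.

Lemma dot3E (u v : 'rV[R]_3) :
  dot u v = u 0 0 * v 0 0 + u 0 1 * v 0 1 + u 0 2%:R * v 0 2%:R.
Proof. exact: sum3E. Qed.

Lemma dot4E (u v : 'rV[R]_4) :
  dot u v = u 0 0 * v 0 0 + u 0 1 * v 0 1 + u 0 2%:R * v 0 2%:R + u 0 3%:R * v 0 3%:R.
Proof. exact: sum4E. Qed.

Lemma ord2P (P : 'I_2 -> Prop) : P 0 -> P 1 -> forall i, P i.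
Proof.
by move=> P0 P1 [[|[|//]] h]; [rewrite (_ : Ordinal h = 0)|rewrite (_ : Ordinal h = 1)];
  rewrite //; apply: val_inj.
Qed.

Lemma ord3P (P : 'I_3 -> Prop) : P 0 -> P 1 -> P 2%:R -> forall i, P i.
Proof.
by move=> P0 P1 P2 [[|[|[|//]]] h];
  [rewrite (_ : Ordinal h = 0)|rewrite (_ : Ordinal h = 1)
  |rewrite (_ : Ordinal h = 2%:R)]; rewrite //; apply: val_inj.
Qed.

Lemma ord4P (P : 'I_4 -> Prop) : P 0 -> P 1 -> P 2%:R -> P 3%:R -> forall i, P i.
Proof.
by move=> P0 P1 P2 P3 [[|[|[|[|//]]]] h];
  [rewrite (_ : Ordinal h = 0)|rewrite (_ : Ordinal h = 1)
  |rewrite (_ : Ordinal h = 2%:R)|rewrite (_ : Ordinal h = 3%:R)];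
  rewrite //; apply: val_inj.
Qed.

Definition nat_mx n (F : nat -> nat -> R) : 'M[R]_n := \matrix_(i, j) F i j.

Lemma det_nat_rec n (F : nat -> nat -> R) :
  \det (nat_mx n.+1 F) =
  \sum_(j < n.+1) F 0 j * ((-1) ^+ j *
    \det (nat_mx n (fun i k => F i.+1 (bump j k)))).
Proof.
rewrite (expand_det_row _ ord0); apply: eq_bigr => j _; rewrite !mxE.
by congr (_ * (_ * \det _)); apply/matrixP => i k; rewrite !mxE.
Qed.

Lemma det3_nat (F : nat -> nat -> R) :
  \det (nat_mx 3 F) =
    F 0 0 * (F 1 1 * F 2 2 - F 1 2 * F 2 1)
    - F 0 1 * (F 1 0 * F 2 2 - F 1 2 * F 2 0)
    + F 0 2 * (F 1 0 * F 2 1 - F 1 1 * F 2 0).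
Proof.
rewrite det_nat_rec !big_ord_recl big_ord0 !det_nat_rec.
rewrite !big_ord_recl !big_ord0 !det_mx11 !mxE /bump /= !expr1 !expr0 expr2; ring.
Qed.

Lemma det4_nat (F : nat -> nat -> R) :
  \det (nat_mx 4 F) =
  let d3 a b c :=
    F 1 a * (F 2 b * F 3 c - F 2 c * F 3 b)
    - F 1 b * (F 2 a * F 3 c - F 2 c * F 3 a)
    + F 1 c * (F 2 a * F 3 b - F 2 b * F 3 a) in
  F 0 0 * d3 1 2 3 - F 0 1 * d3 0 2 3 + F 0 2 * d3 0 1 3 - F 0 3 * d3 0 1 2.
Proof.
rewrite det_nat_rec !big_ord_recl big_ord0 !det3_nat /bump /=.
by rewrite !exprS !expr0; ring.
Qed.

Lemma dotE n (u v : 'rV[R]_n) : dot u v = (u *m v^T) 0 0.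
Proof. by rewrite mxE; apply: eq_bigr => i _; rewrite mxE. Qed.

Lemma stereo_subproof b (u : 'rV[R]_2) : stereo_pt b u \in sphere R 2.
Proof.
apply: mem_set; rewrite /sphere/= dot3E !mxE/=.
have := onep_dot_neq0 u; rewrite dot2E => h.
by case: b; rewrite /= ?expr0 ?expr1; field.
Qed.

Lemma perp_frameK (p : 'rV[R]_4) :
  perp_frame p *m (perp_frame p)^T = (dot p p)%:M.
Proof.
apply/matrixP => i j; rewrite mxE dot4E mxE sum4E !mxE /=.
by elim/ord3P: i; elim/ord3P: j; rewrite /= ?mulr1n ?mulr0n; ring.
Qed.

Lemma perp_frame_orth (p : 'rV[R]_4) : perp_frame p *m p^T = 0.
Proof.
apply/matrixP => i j; rewrite !mxE sum4E !mxE ord1 /=.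
by elim/ord3P: i => /=; ring.
Qed.

Lemma perp_frame_compl (p : 'rV[R]_4) :
  (perp_frame p)^T *m perp_frame p = (dot p p)%:M - p^T *m p.
Proof.
apply/matrixP => i j.
rewrite [LHS]mxE sum3E [RHS]mxE !mxE big_ord1 !mxE dot4E /=.
by elim/ord4P: i; elim/ord4P: j; rewrite /= ?mulr1n ?mulr0n; ring.
Qed.

Lemma perp_frame_lin (q : 'rV[R]_4) :
  perp_frame q = \sum_i q 0 i *: perp_frame (delta_mx 0 i).
Proof.
rewrite sum4E; apply/matrixP => i j; rewrite !mxE /=.
by elim/ord3P: i; elim/ord4P: j => /=; ring.
Qed.

Lemma dotDl n (u v w : 'rV[R]_n) : dot (u + v) w = dot u w + dot v w.
Proof. by rewrite !dotE mulmxDl mxE. Qed.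

Lemma dotZl n a (u v : 'rV[R]_n) : dot (a *: u) v = a * dot u v.
Proof. by rewrite !dotE -scalemxAl mxE. Qed.

Lemma dot0l n (v : 'rV[R]_n) : dot 0 v = 0.
Proof. by rewrite dotE mul0mx mxE. Qed.

Lemma gram_injective n (L : {linear 'rV[R]_2 -> 'rV[R]_n}) k : k != 0 ->
  (forall i j, dot (L (delta_mx 0 i)) (L (delta_mx 0 j)) = k * (i == j)%:R) ->
  injective L.
Proof.
move=> k0 LE v v' vv'; apply/eqP; rewrite -subr_eq0; apply/eqP.
have : L (v - v') = 0 by rewrite linearB vv' subrr.
move: (v - v') => w Lw; apply/rowP => j; rewrite [RHS]mxE.
have : dot (L w) (L (delta_mx 0 j)) = 0 by rewrite Lw dot0l.
rewrite {1}(row_sum_delta w) linear_sum sum2E !linearZ dotDl !dotZl !LE.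
by elim/ord2P : j; rewrite mulr1 mulr0 mulr0 ?addr0 ?add0r => /eqP;
  rewrite mulf_eq0 (negPf k0) orbF => /eqP.
Qed.

Lemma dot_mulmx m n (u v : 'rV[R]_m) (A : 'M[R]_(m, n)) a :
  A *m A^T = a%:M -> dot (u *m A) (v *m A) = a * dot u v.
Proof.
by move=> AA; rewrite !dotE trmx_mul mulmxA -(mulmxA u) AA mul_mx_scalar
  -scalemxAl mxE.
Qed.

Lemma perp_frame_sphere (p : sphere R 3) (y : sphere R 2) :
  set_val y *m perp_frame (set_val p) \in sphere R 3.
Proof.
apply: mem_set; rewrite /sphere/= (dot_mulmx _ _ (perp_frameK _)).
by have /set_mem/= -> := valP p; have /set_mem/= -> := valP y; rewrite mulr1.
Qed.

(* A class of smooth functions stable under partial derivatives which contains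
   the coordinates of the stereographic parametrizations. *)
Inductive rat_fun : ('rV[R]_2 -> R) -> Prop :=
| rat_cst c : rat_fun (fun=> c)
| rat_coord i : rat_fun (fun u : 'rV[R]_2 => u 0 i)
| rat_inv : rat_fun (fun u => (1 + dot u u)^-1)
| rat_add f g : rat_fun f -> rat_fun g -> rat_fun (f \+ g)
| rat_mul f g : rat_fun f -> rat_fun g -> rat_fun (f \* g).

Lemma differentiable_dot (u : 'rV[R]_2) :
  differentiable (fun v : 'rV[R]_2 => 1 + dot v v) u.
Proof.
rewrite (_ : (fun v => _) = cst 1 + ((fun v : 'rV[R]_2 => v 0 0) * (fun v => v 0 0) +
  (fun v => v 0 1) * (fun v => v 0 1))); last first.
  by apply/funext => v; rewrite dot2E.
have dc j : differentiable (fun v : 'rV[R]_2 => v 0 j) u.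
  exact: differentiable_coord.
exact: differentiableD (differentiable_cst _ _) (differentiableD
  (differentiableM (dc 0) (dc 0)) (differentiableM (dc 1) (dc 1))).
Qed.

Lemma rat_fun_diff f u : rat_fun f -> differentiable f u.
Proof.
elim => [c|i||g h _ dg _ dh|g h _ dg _ dh].
- exact: differentiable_cst.
- exact: differentiable_coord.
- apply: differentiableV; [exact: differentiable_dot|exact: onep_dot_neq0].
- exact: differentiableD.
- exact: differentiableM.
Qed.

Lemma rat_fun_derivable f u v : rat_fun f -> derivable f u v.
Proof. by move=> /rat_fun_diff df; exact: diff_derivable. Qed.

Lemma partial_coord i j (u : 'rV[R]_2) :
  partial i (fun v => v 0 j) u = (i == j)%:R.
Proof.
have dI : derivable (id : 'rV[R]_2 -> 'rV[R]_2) u (delta_mx 0 i).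
  exact: derivable_id.
have /(congr1 (fun M : 'rV[R]_2 => M 0 j)) := derive_mx dI.
by rewrite derive_id !mxE eqxx andTb eq_sym => ->.
Qed.

Lemma partialD i f g u : rat_fun f -> rat_fun g ->
  partial i (f \+ g) u = partial i f u + partial i g u.
Proof. by move=> rf rg; apply: deriveD; exact: rat_fun_derivable. Qed.

Lemma partialM i f g u : rat_fun f -> rat_fun g ->
  partial i (f \* g) u = f u * partial i g u + g u * partial i f u.
Proof. by move=> rf rg; apply: deriveM; exact: rat_fun_derivable. Qed.

Lemma partial_cst i c (u : 'rV[R]_2) : partial i (fun=> c : R) u = 0.
Proof. exact: derive_cst. Qed.

Lemma partial_inv i (u : 'rV[R]_2) :
  partial i (fun v => (1 + dot v v)^-1) u = - 2 * u 0 i * (1 + dot u u)^-1 ^+ 2.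
Proof.
have dc := @diff_derivable _ _ _ _ _ (delta_mx 0 i) (differentiable_dot u).
rewrite /partial (@deriveV _ _ (fun v => 1 + dot v v)) ?onep_dot_neq0//.
suff : partial i (fun v : 'rV[R]_2 => 1 + dot v v) u = 2 * u 0 i.
  by rewrite /partial => ->; rewrite /GRing.scale/= exprVn; ring.
have -> : (fun v : 'rV[R]_2 => 1 + dot v v) = (fun=> 1) \+
   (((fun v => v 0 0) \* (fun v => v 0 0)) \+ ((fun v => v 0 1) \* (fun v => v 0 1))).
  by apply/funext => v; rewrite dot2E.
have rc j := rat_coord j; have rm j := rat_mul (rc j) (rc j).
have -> := @partialD i _ _ u (rat_cst 1) (rat_add (rm 0) (rm 1)).
rewrite partialD// !partialM// !partial_coord partial_cst.
by move: {dc} i; apply: ord2P => /=; ring.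
Qed.

Lemma rat_fun_partial i f : rat_fun f -> rat_fun (partial i f).
Proof.
elim => [c|j||g h rg dg rh dh|g h rg dg rh dh].
- rewrite (_ : partial _ _ = fun=> 0); first exact: rat_cst.
  by apply/funext => u; exact: partial_cst.
- rewrite (_ : partial _ _ = fun=> (i == j)%:R : R); first exact: rat_cst.
  by apply/funext => u; exact: partial_coord.
- rewrite (_ : partial _ _ = (fun=> -2 : R) \* (fun u : 'rV[R]_2 => u 0 i) \*
    ((fun u => (1 + dot u u)^-1) \* (fun u => (1 + dot u u)^-1))).
    by do ! apply: rat_mul; try apply: rat_cst; try apply: rat_coord; exact: rat_inv.
  by apply/funext => u; rewrite partial_inv /= expr2.
- rewrite (_ : partial _ _ = partial i g \+ partial i h); first exact: rat_add.
  by apply/funext => u; exact: partialD.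
- rewrite (_ : partial _ _ = g \* partial i h \+ h \* partial i g).
    by apply: rat_add; exact: rat_mul.
  by apply/funext => u; exact: partialM.
Qed.

Definition rat_row n (f : 'rV[R]_2 -> 'rV[R]_n) :=
  forall j, rat_fun (fun u => f u 0 j).

Lemma rat_row_diff n (f : 'rV[R]_2 -> 'rV[R]_n) u :
  rat_row f -> differentiable f u.
Proof.
move=> rf; rewrite (_ : f = \sum_j (fun v => f v 0 j *: delta_mx 0 j)).
  apply: differentiable_sum => j; apply: differentiableZl.
  exact: rat_fun_diff.
by apply/funext => v; rewrite fct_sumE; apply: row_sum_delta.
Qed.

Lemma partial_row n (f : 'rV[R]_2 -> 'rV[R]_n) i u :
  rat_row f -> partial i f u = \row_j partial i (fun v => f v 0 j) u.
Proof.
move=> rf; rewrite /partial derive_mx; last first.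
  by apply: diff_derivable; exact: rat_row_diff.
by apply/rowP => j; rewrite !mxE.
Qed.

Lemma rat_row_partial n (f : 'rV[R]_2 -> 'rV[R]_n) i :
  rat_row f -> rat_row (partial i f).
Proof.
move=> rf j; rewrite (_ : (fun u => _) = partial i (fun u => f u 0 j)).
  exact: rat_fun_partial.
by apply/funext => u; rewrite partial_row// mxE.
Qed.

Lemma rat_row_partials n (f : 'rV[R]_2 -> 'rV[R]_n) w :
  rat_row f -> rat_row (partials w f).
Proof. by move=> rf; elim: w => //= i w; exact: rat_row_partial. Qed.

Lemma rat_row_smooth n (f : 'rV[R]_2 -> 'rV[R]_n) : rat_row f -> smooth f.
Proof. by move=> rf w u; apply: rat_row_diff; exact: rat_row_partials. Qed.

Lemma rat_row_mulmx m n (f : 'rV[R]_2 -> 'rV[R]_m) (A : 'M[R]_(m, n)) :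
  rat_row f -> rat_row (fun v => f v *m A).
Proof.
move=> rf j; have -> : (fun v => (f v *m A) 0 j) =
    \sum_k (fun v => f v 0 k * A k j).
  by apply/funext => v; rewrite fct_sumE mxE.
elim/big_ind : _ => //; first exact: rat_cst.
  by move=> ? ?; exact: rat_add.
by move=> k _; apply: rat_mul; [exact: rf|exact: rat_cst].
Qed.

Lemma partial_mulmx m n (f : 'rV[R]_2 -> 'rV[R]_m) (A : 'M[R]_(m, n)) i u :
  rat_row f -> partial i (fun v => f v *m A) u = partial i f u *m A.
Proof.
move=> rf.
have rg j k : rat_fun (fun v => f v 0 k * A k j).
  by apply: rat_mul; [exact: rf|exact: rat_cst].
have E j : (fun v => (f v *m A) 0 j) = \sum_k (fun v => f v 0 k * A k j).
  by apply/funext => v; rewrite fct_sumE mxE.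
rewrite partial_row; last exact: rat_row_mulmx.
rewrite partial_row//; apply/rowP => j; rewrite !mxE E /partial derive_sum; last first.
  by move=> k; exact: rat_fun_derivable.
apply: eq_bigr => k _; rewrite mxE -/(partial i _ u).
have := @partialM i _ _ u (rf k) (rat_cst (A k j)).
by rewrite partial_cst mulr0 add0r mulrC.
Qed.

Lemma partials_mulmx m n (f : 'rV[R]_2 -> 'rV[R]_m) (A : 'M[R]_(m, n)) w :
  rat_row f -> partials w (fun v => f v *m A) = fun v => partials w f v *m A.
Proof.
move=> rf; elim: w => //= i w ->; apply/funext => u.
by rewrite partial_mulmx//; exact: rat_row_partials.
Qed.

Lemma stereo_ptE b u j : stereo_pt b u 0 j = [::
  ((fun=> 2) \* (fun u : 'rV[R]_2 => u 0 0) \* (fun u => (1 + dot u u)^-1)) u;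
  ((fun=> (-1) ^+ b * 2) \* (fun u : 'rV[R]_2 => u 0 1) \* (fun u => (1 + dot u u)^-1)) u;
  ((fun=> (-1) ^+ b * 2) \* (fun u : 'rV[R]_2 => (1 + dot u u)^-1) \+ (fun=> - (-1) ^+ b)) u]`_j.
Proof.
have := onep_dot_neq0 u; rewrite !mxE => h.
elim/ord3P : j => //=; first by rewrite !mulrA.
by field.
Qed.

Lemma rat_row_stereo b : rat_row (stereo_pt b).
Proof.
move=> j; under eq_fun do rewrite stereo_ptE.
elim/ord3P : j => /=.
- by do 2?apply: rat_mul; [exact: rat_cst|exact: rat_coord|exact: rat_inv].
- by do 2?apply: rat_mul; [exact: rat_cst|exact: rat_coord|exact: rat_inv].
- by apply: rat_add; [apply: rat_mul; [exact: rat_cst|exact: rat_inv]|exact: rat_cst].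
Qed.

Lemma partial_stereo b i u : partial i (stereo_pt b) u =
  let c := 1 + dot u u in
  \row_j [:: 2 * (i == 0)%:R / c - 4 * u 0 0 * u 0 i / c ^+ 2;
     (-1) ^+ b * (2 * (i == 1)%:R / c - 4 * u 0 1 * u 0 i / c ^+ 2);
     (-1) ^+ b * (- 4 * u 0 i / c ^+ 2)]`_j.
Proof.
have h := onep_dot_neq0 u.
rewrite partial_row; last exact: rat_row_stereo.
apply/rowP => j; rewrite !mxE; under eq_fun do rewrite stereo_ptE.
have rc := rat_cst; have rx := rat_coord; have ri := rat_inv.
elim/ord3P : j => /=.
- rewrite (partialM _ _ (rat_mul (rc 2) (rx 0)) ri) (partialM _ _ (rc 2) (rx 0)).
  by rewrite partial_inv partial_coord partial_cst /=; field.
- rewrite (partialM _ _ (rat_mul (rc _) (rx 1)) ri) (partialM _ _ (rc _) (rx 1)).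
  by rewrite partial_inv partial_coord partial_cst /=; field.
- rewrite (partialD _ _ (rat_mul (rc _) ri) (rc _)) (partialM _ _ (rc _) ri).
  by rewrite partial_inv !partial_cst /=; field.
Qed.

Lemma dot_partial_stereo b i j u :
  dot (partial i (stereo_pt b) u) (partial j (stereo_pt b) u) =
  4 * (1 + dot u u) ^- 2 * (i == j)%:R.
Proof.
have := onep_dot_neq0 u; rewrite dot3E !partial_stereo !mxE/= dot2E => h.
by case: b; rewrite ?expr0 ?expr1; elim/ord2P : i; elim/ord2P: j => /=; field.
Qed.

Section conformal.
Variable g : 'rV[R]_2 -> 'M[R]_2.
Hypothesis gE : g = fun u => (4 * (1 + dot u u) ^- 2)%:M.

Lemma round_partial k i j u :
  partial k (fun v => g v i j) u =
  (i == j)%:R * (- 16 * u 0 k * (1 + dot u u) ^- 3).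
Proof.
have -> : (fun v => g v i j) = (fun=> (i == j)%:R * 4) \*
    ((fun u => (1 + dot u u)^-1) \* (fun u => (1 + dot u u)^-1)).
  apply/funext => v; rewrite gE mxE /= -exprVn expr2 -mulr_natr; ring.
have h := onep_dot_neq0 u.
rewrite (partialM _ _ (rat_cst _) (rat_mul rat_inv rat_inv)).
by rewrite (partialM _ _ rat_inv rat_inv) partial_inv partial_cst /=; field.
Qed.

Definition round_gamma (k i j : 'I_2) : 'rV[R]_2 -> R :=
  ((fun=> -2 * (j == k)%:R) \* (fun u : 'rV[R]_2 => u 0 i) \+
   ((fun=> -2 * (i == k)%:R) \* (fun u : 'rV[R]_2 => u 0 j) \+
    (fun=> 2 * (i == j)%:R) \* (fun u : 'rV[R]_2 => u 0 k))) \* (fun u => (1 + dot u u)^-1).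

Lemma round_christoffel k i j : christoffel g k i j = round_gamma k i j.
Proof.
apply/funext => u; rewrite /christoffel /round_gamma /= sum2E !round_partial.
have h := onep_dot_neq0 u.
have h4 : 4 * (1 + dot u u) ^- 2 != 0.
  by rewrite mulf_neq0 ?invr_eq0 ?expf_neq0// pnatr_eq0.
rewrite gE invmx_scalar !mxE.
elim/ord2P: i; elim/ord2P: j; elim/ord2P: k => /=; rewrite ?mulr1n ?mulr0n; field;
  by rewrite h.
Qed.

Lemma round_gamma_partial m k i j u : partial m (round_gamma k i j) u =
  (-2 * (j == k)%:R * (m == i)%:R - 2 * (i == k)%:R * (m == j)%:R
   + 2 * (i == j)%:R * (m == k)%:R) / (1 + dot u u)
  - 2 * u 0 m / (1 + dot u u) * round_gamma k i j u.
Proof.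
have h := onep_dot_neq0 u.
have rm c n : rat_fun ((fun=> c) \* (fun u : 'rV[R]_2 => u 0 n)).
  by apply: rat_mul; [exact: rat_cst|exact: rat_coord].
have pm c n : partial m ((fun=> c) \* (fun u : 'rV[R]_2 => u 0 n)) u = c * (m == n)%:R.
  rewrite (partialM _ _ (rat_cst c) (rat_coord n)) partial_coord partial_cst.
  by rewrite mulr0 addr0.
have ra c n c' n' := rat_add (rm c n) (rm c' n').
rewrite (partialM _ _ (rat_add (rm _ _) (ra _ _ _ _)) rat_inv) partial_inv.
rewrite (partialD _ _ (rm _ _) (ra _ _ _ _)) (partialD _ _ (rm _ _) (rm _ _)) !pm.
by rewrite /round_gamma /=; field.
Qed.

Lemma round_curvature u : gauss_curvature g u = 1.
Proof.
have h := onep_dot_neq0 u.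
rewrite /gauss_curvature sum2E /riemann !sum2E !round_christoffel.
rewrite !round_gamma_partial /round_gamma gE det_scalar !mxE /= ?mulr1n ?mulr0n.
move: h; rewrite dot2E => h; field.
by rewrite h.
Qed.

End conformal.

End Calculus.

Section Surfaces.
Variable R : realType.
Local Notation S2 := (sphere R 2).
Local Notation S3 := (sphere R 3).

Definition stereo b u : S2 := exist _ (stereo_pt b u) (stereo_subproof b u).

Definition in_chart n (x : S2 -> sphere R n) (b : bool) (u : 'rV[R]_2) :
  'rV[R]_n.+1 := set_val (x (stereo b u)).

Definition smooth_map n (x : S2 -> sphere R n) := forall b, smooth (in_chart x b).

(* "injective ('d _ u)" does not depend on the chart, nor does the curvature
   below; requiring both in the two charts covers all points of S2. *)
Definition immersion n (x : S2 -> sphere R n) :=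
  smooth_map x /\ forall b u, injective ('d (in_chart x b) u).

Definition curved_immersion_set : set (S2 -> S3) :=
  [set x | immersion x /\
    forall b u, 0 < gauss_curvature (metric (in_chart x b)) u].

Definition curved_immersion : Type := set_type curved_immersion_set.
HB.instance Definition _ := Choice.on curved_immersion.

(* The C^oo topology: uniform convergence on compact sets, in each chart, of all
   partial derivatives. *)
Definition jets (x : curved_immersion) :
  prod_topology
    (fun _ : bool * seq 'I_2 => {compact-open, 'rV[R]_2 -> 'rV[R]_4}) :=
  fun bw => partials bw.2 (in_chart (set_val x) bw.1).

HB.instance Definition _ :=
  Topological.copy curved_immersion (initial_topology jets).

(* S2 is oriented as the boundary of the unit ball, and both charts "stereo b" are
   positively oriented; the determinant has the sign of the Jacobian of phi. *)
Definition oriented_diffeo (phi : S2 -> S2) :=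
  (exists psi, [/\ cancel phi psi, cancel psi phi, smooth_map phi & smooth_map psi])
  /\ forall b u, let f := in_chart phi b in
     0 < frame_det [tuple f u; partial 0 f u; partial 1 f u].

Definition reparam_orbit (x : curved_immersion) : set curved_immersion :=
  [set y | exists2 phi, oriented_diffeo phi & set_val y = set_val x \o phi].

(* The quotient by a group action, realised as the set of orbits; it gets the
   quotient topology in oriented_surface. *)
Definition orbit_space : Type := set_type (range reparam_orbit).

Definition orbit_space_pi (x : curved_immersion) : orbit_space :=
  exist _ (reparam_orbit x) (mem_set (imageT reparam_orbit x)).

Definition orbit_space_repr (C : orbit_space) : curved_immersion :=
  sval (cid2 (set_mem (svalP C))).

Lemma orbit_space_reprK : cancel orbit_space_repr orbit_space_pi.
Proof.
move=> C; apply: val_inj; rewrite /= /orbit_space_repr.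
by case: cid2 => x /= _ ->.
Qed.

HB.instance Definition _ :=
  isQuotient.Build curved_immersion orbit_space orbit_space_reprK.

Definition oriented_surface : Type := quotient_topology orbit_space.
HB.instance Definition _ :=
  Quotient.copy oriented_surface (quotient_topology orbit_space).
HB.instance Definition _ :=
  Topological.copy oriented_surface (quotient_topology orbit_space).

(* A linear isometry of S2 onto the great sphere orthogonal to p. *)
Definition great_sphere_map (p : S3) (y : S2) : S3 :=
  exist _ (set_val y *m perp_frame (set_val p)) (perp_frame_sphere p y).

Lemma great_sphere_map_curved p : great_sphere_map p \in curved_immersion_set.
Proof.
have /set_mem/= pp := valP p.
have BB : perp_frame (set_val p) *m (perp_frame (set_val p))^T = 1%:M.
  by rewrite perp_frameK pp.
have rs b := @rat_row_stereo R b.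
have pE b i u : partial i (in_chart (great_sphere_map p) b) u =
    partial i (stereo_pt b) u *m perp_frame (set_val p).
  exact: (@partial_mulmx R 3 4 (stereo_pt b) (perp_frame (set_val p)) i u (rs b)).
have sm : smooth_map (great_sphere_map p).
  by move=> b; apply: rat_row_smooth;
    exact: (@rat_row_mulmx R 3 4 (stereo_pt b) (perp_frame (set_val p)) (rs b)).
have gE b u i j : dot (partial i (in_chart (great_sphere_map p) b) u)
    (partial j (in_chart (great_sphere_map p) b) u) =
    4 * (1 + dot u u) ^- 2 * (i == j)%:R.
  by rewrite !pE (dot_mulmx _ _ BB) mul1r dot_partial_stereo.
apply: mem_set; split; first split=> // b u.
  apply: (gram_injective (k := 4 * (1 + dot u u) ^- 2)).
    by rewrite mulf_neq0 ?invr_eq0 ?expf_neq0 ?onep_dot_neq0// pnatr_eq0.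
  have df : differentiable (in_chart (great_sphere_map p) b) u := sm b [::] u.
  have dE i : 'd (in_chart (great_sphere_map p) b) u (delta_mx 0 i) =
      partial i (in_chart (great_sphere_map p) b) u by rewrite /partial deriveE.
  by move=> i j; rewrite !dE gE.
move=> b u; rewrite (round_curvature (g := metric _))//.
apply/funext => v; apply/matrixP => i j; rewrite !mxE gE.
by case: eqP; rewrite ?mulr1 ?mulr0.
Qed.

Definition great_sphere_immersion (p : S3) : curved_immersion :=
  exist _ (great_sphere_map p) (great_sphere_map_curved p).

(* S_p; great_sphere_range and great_sphere_unit_normal check that its image is
   the great sphere orthogonal to p and that its unit normal is p. *)
Definition great_sphere (p : S3) : oriented_surface :=
  \pi_oriented_surface%qT (great_sphere_immersion p).

(* S3 is oriented as the boundary of the unit ball of R^4, and the normal n of an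
   oriented surface x is such that (d_0 x, d_1 x, n) is a positive basis of the
   tangent space of S3 for positive coordinates on S2. *)
Definition unit_normal (x : curved_immersion) (n : S2 -> S3) :=
  forall b u, let f := in_chart (set_val x) b in let nu := in_chart n b u in
  [/\ dot (f u) nu = 0, forall i, dot (partial i f u) nu = 0
    & 0 < frame_det [tuple f u; partial 0 f u; partial 1 f u; nu]].

Lemma great_sphere_range (p : S3) :
  range (great_sphere_map p) = [set q | dot (set_val q) (set_val p) = 0].
Proof.
have /set_mem/= pp := valP p.
apply/seteqP; split=> [_ [y _ <-]|q qp] /=.
  by rewrite dotE -mulmxA perp_frame_orth mulmx0 mxE.
pose y := set_val q *m (perp_frame (set_val p))^T.
have yB : y *m perp_frame (set_val p) = set_val q.
  rewrite -mulmxA perp_frame_compl pp mulmxBr mulmx1 mulmxA.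
  have -> : set_val q *m (set_val p)^T = 0.
    by apply/matrixP => i j; rewrite !ord1 -dotE qp mxE.
  by rewrite mul0mx subr0.
have yy : y \in S2.
  apply: mem_set; rewrite /sphere/=; have /set_mem/= <- := valP q.
  by rewrite -[RHS](congr2 (@dot R 4) yB yB) (dot_mulmx _ _ (perp_frameK _)) pp mul1r.
by exists (exist _ y yy) => //; apply: val_inj.
Qed.

Lemma great_sphere_unit_normal (p : S3) :
  unit_normal (great_sphere_immersion p) (cst p).
Proof.
move=> b u f nu.
have pp : dot (set_val p) (set_val p) = 1 by exact: (set_mem (valP p)).
have fE : f = fun v => stereo_pt b v *m perp_frame (set_val p) by [].
have pE i : partial i f u = partial i (stereo_pt b) u *m perp_frame (set_val p).
  by rewrite fE partial_mulmx//; exact: rat_row_stereo.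
have nuE : nu = set_val p by [].
split=> [|i|].
- by rewrite fE nuE dotE -mulmxA perp_frame_orth mulmx0 mxE.
- by rewrite pE nuE dotE -mulmxA perp_frame_orth mulmx0 mxE.
rewrite /frame_det fE !pE nuE.
move: (set_val p) pp => {fE pE nuE f nu} q qq.
set e := [:: stereo_pt b u; partial 0 (stereo_pt b) u; partial 1 (stereo_pt b) u].
pose F i j : R := if i is 3 then (j == 3)%:R else
  if j is 0 then (nth 0 e i) 0 0 else if j is 1 then (nth 0 e i) 0 1 else
  if j is 2 then (nth 0 e i) 0 2%:R else 0.
pose G i j : R := (nth [::] [:: [:: q 0 1; - q 0 0; - q 0 3%:R; q 0 2%:R];
  [:: q 0 2%:R; q 0 3%:R; - q 0 0; - q 0 1];
  [:: q 0 3%:R; - q 0 2%:R; q 0 1; - q 0 0];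
  [:: q 0 0; q 0 1; q 0 2%:R; q 0 3%:R]] i)`_j.
set A := \matrix_i _.
have -> : A = nat_mx 4 F *m nat_mx 4 G.
  apply/matrixP => i j; rewrite [LHS]mxE [RHS]mxE sum4E !mxE.
  by elim/ord4P: i; elim/ord4P: j;
    rewrite /tnth/= ?mxE ?sum3E ?mxE /F /G /=; ring.
have GE : \det (nat_mx 4 G) = 1.
  by transitivity (dot q q ^+ 2); [rewrite det4_nat dot4E /G /=; ring|rewrite qq expr1n].
have h := onep_dot_neq0 u.
have FE : \det (nat_mx 4 F) = 4 * (1 + dot u u) ^- 2.
  rewrite det4_nat /F /= !partial_stereo !mxE /=.
  by move: h; rewrite dot2E => h; case: (b); rewrite ?expr0 ?expr1 /=; field.
by rewrite det_mulmx GE FE mulr1 mulr_gt0// invr_gt0 exprn_gt0 ?onep_dot_gt0.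
Qed.

Lemma great_sphere_continuous : continuous great_sphere.
Proof.
suff : continuous great_sphere_immersion.
  by move=> h p; apply: continuous_comp; [exact: h|exact: pi_continuous].
apply: continuous_comp_initial => p.
have FF : Filter ((jets \o great_sphere_immersion) x @[x --> p]).
  by apply: fmap_filter; exact: nbhs_filter.
apply/cvg_sup => -[b w].
pose F (z : S3 * 'rV[R]_2) : 'rV[R]_4 :=
  partials w (stereo_pt b) z.2 *m perp_frame (set_val z.1).
pose G i (z : S3 * 'rV[R]_2) : 'rV[R]_4 := set_val z.1 0 i *:
  (partials w (stereo_pt b) z.2 *m perp_frame (delta_mx 0 i)).
have Gc i : continuous (G i).
  move=> z; apply: cvgZ.
    apply: (continuous_comp (f := fun z : S3 * 'rV[R]_2 => set_val z.1)
      (g := fun q : 'rV[R]_4 => q 0 i)); last exact: coord_continuous.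
    apply: (continuous_comp (f := fst)); first exact: cvg_fst.
    exact: initial_continuous.
  apply: (continuous_comp (f := snd) (g := fun v =>
    partials w (stereo_pt b) v *m perp_frame (delta_mx 0 i))).
    exact: cvg_snd.
  apply: differentiable_continuous; apply: rat_row_diff; apply: rat_row_mulmx.
  by apply: rat_row_partials; exact: rat_row_stereo.
have Fc : continuous F.
  have -> : F = fun z => G 0 z + G 1 z + G 2%:R z + G 3%:R z.
    apply/funext => z; rewrite /F {1}perp_frame_lin mulmx_sumr sum4E.
    by rewrite /G !scalemxAr.
  move=> z; apply: cvgD; last exact: Gc.
  by apply: cvgD; last exact: Gc; apply: cvgD; exact: Gc.
have FE : (fun f => f (b, w)) \o (jets \o great_sphere_immersion) = curry F.
  apply/funext => q; rewrite /curry /F /=.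
  by rewrite -(partials_mulmx _ _ (@rat_row_stereo R b)).
have cF : continuous (curry F : S3 -> {compact-open, 'rV[R]_2 -> 'rV[R]_4}).
  exact: continuous_curry_fun.
rewrite -FE in cF.
exact: (continuous_comp_initial cF).
Qed.

End Surfaces.

(* Main.v *)
Require Import Defs.
From HB Require Import structures.
From mathcomp Require Import all_boot all_order all_algebra finmap ring lra.
From mathcomp Require Import all_classical all_reals all_analysis.
Import Order.TTheory GRing.Theory Num.Theory.
Import numFieldNormedType.Exports.
Set Implicit Arguments.
Unset Strict Implicit.
Unset Printing Implicit Defensive.
Local Open Scope classical_set_scope.
Local Open Scope ring_scope.

(* Identify R^4 with the quaternions. Reading the unit normal nu of a surface x
   in the left-invariant frame perp_frame x of S^3 gives a left Gauss map
   G : S^2 -> S^2. In that frame the derivative of nu differs from minus the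
   second fundamental form A by a rotation J of angle pi/2, so the Jacobian of G
   is det (A + J) = 1 + det A, which is the intrinsic curvature. Positive
   curvature therefore makes G a local homeomorphism, hence a bijection. Let z
   be the unique point where G takes a fixed value e, i.e. where nu agrees with
   the left-invariant unit field e. The retraction sends x to nu(z): this depends
   continuously on x, does not depend on the parametrization, and equals p for
   S_p, whose normal is constantly p. *)

(** * Partial derivatives and the Gauss equation *)

(** Curvature is defined intrinsically, while [G] is extrinsic; the Gauss equation in [R^4] links
    them. The normal part of the second derivatives of a surface has a component along the position
    vector, which yields the 1 in 1 + det A, and one along nu, which yields det A. So K > 0 is a
    sign condition on the Jacobian of [G] and not on A: det A may be negative, and no convexity is
    available. The rotation J is a torsion effect: left-invariant fields are parallel for a flat
    connection that differs from the Levi-Civita connection by the cross product. Local bijectivity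
    of [G] is split in two: injectivity comes from the mean value theorem, openness from maximising
    <G, y> over small balls. The global step needs only uniform radii of injectivity and lifting,
    obtained by compactness, so that paths can be lifted in discrete steps. Continuity in x rests on
    the uniqueness of z: since z ranges over a compact set, it suffices to control pairs (x, u) near
    each (x0, u0). *)

Section DirectionalCalculus.
Variables (R : realType) (V : normedModType R).

Lemma is_derive_line (f : V -> R) (a v : V) (t : R) :
  (forall u, differentiable f u) ->
  is_derive t 1 (fun s : R => f (a + s *: v)) ('D_v f (a + t *: v)).
Proof.
move=> df; have dv : derivable f (a + t *: v) v by exact: diff_derivable.
have E : (fun h : R => h^-1 *: (((fun s => f (a + s *: v)) \o shift t) (h *: 1)
     - f (a + t *: v))) =
   (fun h : R => h^-1 *: ((f \o shift (a + t *: v)) (h *: v) - f (a + t *: v))).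
  apply/funext => h /=; rewrite [h *: 1]mulr1 scalerDl.
  by rewrite (addrCA a).
by apply: DeriveDef; rewrite /derivable /derive E.
Qed.

Lemma derive_translate (f : V -> R) (c v u : V) :
  'D_v (fun z => f (z + c)) u = 'D_v f (u + c).
Proof.
rewrite /derive; set g := fun h => _; set g' := fun h => _.
by have -> : g = g' by apply/funext => h; rewrite /g /g' /= addrA.
Qed.

Lemma line_MVT (f : V -> R) (a v : V) (h : R) :
  (forall u, differentiable f u) -> 0 < h ->
  exists2 t, 0 < t < h & f (a + h *: v) - f a = h * 'D_v f (a + t *: v).
Proof.
move=> df h0.
have D t := is_derive_line a v t df.
have cf : {within `[0, h], continuous (fun s : R => f (a + s *: v))}.
  apply: continuous_subspaceT => t; apply: differentiable_continuous.
  by apply/derivable1_diffP; case: (D t).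
have [t t0h] := MVT h0 (fun t _ => D t) cf.
by rewrite scale0r addr0 subr0 mulrC => ->; exists t => //; move: t0h; rewrite in_itv.
Qed.

(* Both sides are limits of the same second difference quotient. *)
Lemma derive_comm (f : V -> R) (v w u : V) :
  (forall z, differentiable f z) ->
  (forall z, differentiable ('D_v f) z) -> (forall z, differentiable ('D_w f) z) ->
  {for u, continuous ('D_w ('D_v f))} -> {for u, continuous ('D_v ('D_w f))} ->
  'D_w ('D_v f) u = 'D_v ('D_w f) u.
Proof.
move=> df dv dw cwv cvw; apply/eqP; rewrite -subr_eq0; apply/eqP.
(* Mean value theorem twice: along [v'] for the increment of [f'] in direction [h *: w'], then along
   [w'] for the derivative ['D_v' f']. *)
have key (f' : V -> R) (v' w' : V) (h : R) : (forall z, differentiable f' z) ->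
    (forall z, differentiable ('D_v' f') z) -> 0 < h ->
    exists s t, [/\ 0 < s < h, 0 < t < h & f' (u + h *: w' + h *: v') - f' (u + h *: w')
      - (f' (u + h *: v') - f' u) = h ^+ 2 * 'D_w' ('D_v' f') (u + s *: v' + t *: w')].
  move=> {}df {}dv h0.
  pose g z := f' (z + h *: w') - f' z.
  have dsh z : differentiable (fun z => f' (z + h *: w')) z.
    exact: (@differentiable_comp _ _ _ _ (fun z => z + h *: w') f').
  have dg z : differentiable g z by apply: (@differentiableB _ _ _ _ f').
  have [s s0h gE] := @line_MVT g u v' h dg h0.
  have [t t0h DE] := @line_MVT ('D_v' f') (u + s *: v') w' h dv h0.
  exists s, t; split => //; rewrite expr2 -mulrA -DE.
  transitivity (g (u + h *: v') - g u); first by rewrite /g (addrAC u); ring.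
  rewrite gE; congr (_ * _); rewrite /g deriveB; last 2 first.
  - exact: diff_derivable.
  - exact: diff_derivable.
  by rewrite derive_translate.
have {}key (h : R) : 0 < h -> exists s t s' t', [/\ 0 < s < h, 0 < t < h, 0 < s' < h, 0 < t' < h &
     'D_w ('D_v f) (u + s *: v + t *: w) = 'D_v ('D_w f) (u + s' *: w + t' *: v)].
  move=> h0; have [s [t [s0 t0 E]]] := key f v w h df dv h0.
  have [s' [t' [s0' t0' E']]] := key f w v h df dw h0.
  exists s, t, s', t'; split; [exact: s0|exact: t0|exact: s0'|exact: t0'|].
  have h20 : h ^+ 2 != 0 by rewrite expf_neq0// gt_eqF.
  apply: (mulfI h20); apply: etrans (esym E) (etrans _ E').
  have sw (a b c d : R) : a - b - (c - d) = a - c - (b - d) by ring.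
  by rewrite sw (addrAC u (h *: w)).
apply/eqP; rewrite -normr_le0; apply/ler_addgt0Pr => e e0; rewrite add0r.
pose c (x : V) (y : V) (p : R * R) := u + p.1 *: x + p.2 *: y.
have cc x y : {for (0, 0) : R * R, continuous (c x y)}.
  apply: cvgD; first by apply: cvgD; [exact: cvg_cst|apply: cvgZr_tmp; exact: cvg_fst].
  by apply: cvgZr_tmp; exact: cvg_snd.
have c0 x y : c x y (0, 0) = u by rewrite /c /= !scale0r !addr0.
have lim (g : V -> R) x y : {for u, continuous g} ->
    \forall s & t \near (0 : R), `|g u - g (c x y (s, t))| < e / 2.
  move=> cg; have : {for (0, 0) : R * R, continuous (g \o c x y)}.
    by apply: continuous_comp; [exact: cc|rewrite c0].
  move=> /cvgrPdist_lt /(_ (e / 2)) /(_ ltac:(by rewrite divr_gt0)).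
  by rewrite /= c0.
have [[A B] [/= A0 B0]] := lim _ v w cwv.
have [[A' B'] [/= A0' B0']] := lim _ w v cvw.
move=> AB' AB.
have : \forall h \near (0 : R)^'+, forall s, 0 < s < h -> (A `&` B `&` A' `&` B') s.
  have [r /= r0 rP] : nbhs (0 : R) (A `&` B `&` A' `&` B') by do 3!apply: filterI => //.
  near=> h => s /andP[s0 sh]; apply: rP; rewrite /ball/= sub0r normrN gtr0_norm//.
  by rewrite (lt_trans sh)//; near: h; exact: nbhs_right_lt.
move=> /(filterI (nbhs_right_gt 0)) /filter_ex[h [h0 hP]].
have [s [t [s' [t' [s0 t0 s0' t0' E]]]]] := key _ h0.
have [[[As _] _] _] := hP _ s0; have [[[_ Bt] _] _] := hP _ t0.
have [[_ As'] _] := hP _ s0'; have [_ Bt'] := hP _ t0'.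
have L1 := AB (s, t) (conj As Bt); have L2 := AB' (s', t') (conj As' Bt').
rewrite -(subrK ('D_w ('D_v f) (u + s *: v + t *: w)) ('D_w ('D_v f) u)) -addrA.
apply: le_trans (ler_normD _ _) _; rewrite (splitr e); apply: lerD.
  exact: ltW L1.
by rewrite E distrC; exact: ltW L2.
Unshelve. all: by end_near. Qed.

End DirectionalCalculus.

Section DotProduct.
Variable R : realType.

Lemma dotC n (u v : 'rV[R]_n) : dot u v = dot v u.
Proof. by apply: eq_bigr => i _; rewrite mulrC. Qed.

Lemma dotDr n (u v w : 'rV[R]_n) : dot u (v + w) = dot u v + dot u w.
Proof. by rewrite dotC dotDl !(dotC u). Qed.

Lemma dotZr n a (u v : 'rV[R]_n) : dot u (a *: v) = a * dot u v.
Proof. by rewrite dotC dotZl dotC. Qed.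

Lemma dotNl n (u v : 'rV[R]_n) : dot (- u) v = - dot u v.
Proof. by rewrite -scaleN1r dotZl mulN1r. Qed.

Lemma dotBl n (u v w : 'rV[R]_n) : dot (u - v) w = dot u w - dot v w.
Proof. by rewrite dotDl dotNl. Qed.

Lemma dotBr n (u v w : 'rV[R]_n) : dot u (v - w) = dot u v - dot u w.
Proof. by rewrite dotC dotBl !(dotC u). Qed.

Lemma dot_ge0 n (u : 'rV[R]_n) : 0 <= dot u u.
Proof. by apply: sumr_ge0 => i _; rewrite -expr2 sqr_ge0. Qed.

Lemma dot_eq0 n (u : 'rV[R]_n) : (dot u u == 0) = (u == 0).
Proof.
apply/eqP/eqP => [|->]; last exact: dot0l.
move=> /eqP; rewrite psumr_eq0 => [/allP h|i _]; last by rewrite -expr2 sqr_ge0.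
apply/rowP => i; have /(_ i (mem_index_enum _)) := h.
by rewrite implyTb -expr2 sqrf_eq0 mxE => /eqP.
Qed.

End DotProduct.

(* Sealed, as otherwise unification unfolds nested partial derivatives. *)
HB.lock Definition pd (R : realType) (W : normedModType R) (i : 'I_2) (f : 'rV[R]_2 -> W) :
  'rV[R]_2 -> W := partial i f.
Canonical pd_unlockable := Unlockable pd.unlock.

(** * Differential calculus of row-valued maps on the plane *)

Section VectorCalculus.
Variable R : realType.
Implicit Types u : 'rV[R]_2.

Lemma differentiable_rowP (V : normedModType R) n (f : V -> 'rV[R]_n) (u : V) :
  differentiable f u <-> forall j, differentiable (fun v => f v 0 j) u.
Proof.
split=> [df j|df].
  exact: (@differentiable_comp _ _ _ _ f (fun x : 'rV[R]_n => x 0 j) _ df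
    (differentiable_coord _ _ _)).
rewrite (_ : f = \sum_j (fun v => f v 0 j *: delta_mx 0 j)).
  by apply: differentiable_sum => j; exact: differentiableZl.
by apply/funext => v; rewrite fct_sumE; apply: row_sum_delta.
Qed.

Lemma pd_row n (f : 'rV[R]_2 -> 'rV[R]_n) i j u :
  differentiable f u -> (pd i f u) 0 j = pd i (fun v => f v 0 j) u.
Proof.
by move=> df; rewrite unlock /partial derive_mx ?mxE//; exact: diff_derivable.
Qed.

Lemma pd_cst (W : normedModType R) (c : W) i u : pd i (fun=> c) u = 0.
Proof. by rewrite unlock; exact: derive_cst. Qed.

Lemma pd_sum n (f : 'I_n -> 'rV[R]_2 -> R) i u :
  (forall j, differentiable (f j) u) ->
  pd i (fun v => \sum_j f j v) u = \sum_j pd i (f j) u.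
Proof.
move=> df; rewrite unlock /partial (_ : (fun v => _) = \sum_j f j); last first.
  by apply/funext => v; rewrite fct_sumE.
by rewrite derive_sum// => j; exact: diff_derivable.
Qed.

Lemma pdM (f g : 'rV[R]_2 -> R) i u : differentiable f u -> differentiable g u ->
  pd i (fun v => f v * g v) u = pd i f u * g u + f u * pd i g u.
Proof.
move=> df dg; rewrite unlock /partial.
apply: etrans (deriveM (diff_derivable df) (diff_derivable dg)) _.
by rewrite addrC /GRing.scale/= mulrC.
Qed.

Lemma differentiable_dotv n (f g : 'rV[R]_2 -> 'rV[R]_n) u :
  differentiable f u -> differentiable g u -> differentiable (fun v => dot (f v) (g v)) u.
Proof.
move=> /differentiable_rowP df /differentiable_rowP dg.
rewrite (_ : (fun v => _) = \sum_j ((fun v => f v 0 j) * (fun v => g v 0 j))).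
  by apply: differentiable_sum => j; exact: differentiableM.
by apply/funext => v; rewrite fct_sumE.
Qed.

Lemma pd_dot n (f g : 'rV[R]_2 -> 'rV[R]_n) i u :
  differentiable f u -> differentiable g u ->
  pd i (fun v => dot (f v) (g v)) u = dot (pd i f u) (g u) + dot (f u) (pd i g u).
Proof.
move=> df dg; have dfj := (differentiable_rowP f u).1 df.
have dgj := (differentiable_rowP g u).1 dg.
apply: etrans (pd_sum i (fun j => differentiableM (dfj j) (dgj j))) _.
rewrite -big_split; apply: eq_bigr => j _ /=.
by apply: etrans (pdM i (dfj j) (dgj j)) _; rewrite !pd_row.
Qed.

Lemma mulmx_dot m n (x : 'rV[R]_m) (A : 'M[R]_(m, n)) j :
  (x *m A) 0 j = dot x (row j A^T).
Proof. by rewrite mxE; apply: eq_bigr => k _; rewrite !mxE. Qed.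

Lemma differentiable_mulmx m n (f : 'rV[R]_2 -> 'rV[R]_m) (A : 'M[R]_(m, n)) u :
  differentiable f u -> differentiable (fun v => f v *m A) u.
Proof.
move=> df; apply/differentiable_rowP => j; under eq_fun do rewrite mulmx_dot.
by apply: differentiable_dotv => //; exact: differentiable_cst.
Qed.

Lemma pd_mulmx m n (f : 'rV[R]_2 -> 'rV[R]_m) (A : 'M[R]_(m, n)) i u :
  differentiable f u -> pd i (fun v => f v *m A) u = pd i f u *m A.
Proof.
move=> df; apply/rowP => j; rewrite pd_row; last exact: differentiable_mulmx.
under eq_fun do rewrite mulmx_dot.
by rewrite mulmx_dot pd_dot// pd_cst (dotC _ 0) dot0l addr0.
Qed.

Lemma smooth_pd (W : normedModType R) (f : 'rV[R]_2 -> W) i : smooth f -> smooth (pd i f).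
Proof.
move=> sf w v; have := sf (rcons w i) v.
by rewrite /partials foldr_rcons unlock.
Qed.

Lemma smooth_diff (W : normedModType R) (f : 'rV[R]_2 -> W) u : smooth f -> differentiable f u.
Proof. by move=> sf; exact: (sf [::]). Qed.

Lemma pd_comm n (f : 'rV[R]_2 -> 'rV[R]_n) i j u :
  smooth f -> pd i (pd j f) u = pd j (pd i f) u.
Proof.
move=> sf; have df v : differentiable f v by exact: smooth_diff.
have df1 k v : differentiable (pd k f) v by apply: smooth_diff; exact: smooth_pd.
have df2 k l v : differentiable (pd l (pd k f)) v.
  by apply: smooth_diff; do 2!apply: smooth_pd.
apply/rowP => c; rewrite (pd_row i c (df1 j u)) (pd_row j c (df1 i u)).
have E k : (fun v => pd k f v 0 c) = pd k (fun v => f v 0 c).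
  by apply/funext => v; rewrite pd_row.
have E2 k l : (fun v => pd l (pd k f) v 0 c) = pd l (pd k (fun v => f v 0 c)).
  by apply/funext => v; rewrite pd_row// E.
have D0 z : differentiable (fun v => f v 0 c) z by move: c {E E2}; apply/differentiable_rowP.
have D1 k z : differentiable (pd k (fun v => f v 0 c)) z.
  by rewrite -E; move: c {E E2 D0}; apply/differentiable_rowP.
have D2 k l z : differentiable (pd k (pd l (fun v => f v 0 c))) z.
  by rewrite -E2; move: c {E E2 D0 D1}; apply/differentiable_rowP.
rewrite (E i) (E j); move: D0 D1 D2; rewrite unlock => D0 D1 D2.
exact: (derive_comm D0 (D1 j) (D1 i) (differentiable_continuous (D2 i j u))
  (differentiable_continuous (D2 j i u))).
Qed.

End VectorCalculus.

Lemma det_mx2 (R : realType) (A : 'M[R]_2) : \det A = A 0 0 * A 1 1 - A 0 1 * A 1 0.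
Proof.
rewrite (expand_det_row _ 0) sum2E /cofactor !det_mx11 !mxE /= expr0 expr1.
by rewrite mul1r mulN1r mulrN; congr (_ * A _ _ - _ * A _ _); apply: val_inj.
Qed.

(** * The Gauss equation of an immersed patch in [R^n] *)

Section GaussEquation.
Variables (R : realType) (n : nat) (f : 'rV[R]_2 -> 'rV[R]_n).
Hypothesis sf : smooth f.
Hypothesis detg : forall u, \det (metric f u) != 0.

Local Notation f1 i := (pd i f).
Local Notation f2 i j := (pd i (pd j f)).
Local Notation f3 i j k := (pd i (pd j (pd k f))).
Local Notation Gam := (christoffel (metric f)).

Let g i j u := dot (f1 i u) (f1 j u).

Let metricE i j u : metric f u i j = g i j u.
Proof. by rewrite mxE /g unlock. Qed.

Let d1 i u : differentiable (f1 i) u.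
Proof. by apply: smooth_diff; exact: smooth_pd. Qed.

Let d2 i j u : differentiable (f2 i j) u.
Proof. by apply: smooth_diff; do 2!apply: smooth_pd. Qed.

Let pd_g i j k u : pd k (g i j) u = dot (f2 k i u) (f1 j u) + dot (f1 i u) (f2 k j u).
Proof. exact: pd_dot. Qed.

Let gC i j u : g i j u = g j i u. Proof. exact: dotC. Qed.

Let detE u : \det (metric f u) = g 0 0 u * g 1 1 u - g 0 1 u * g 0 1 u.
Proof. by rewrite det_mx2 !metricE (gC 1 0). Qed.

Let christoffelE k i j u : Gam k i j u =
  2^-1 * \sum_l invmx (metric f u) k l * (pd i (g j l) u + pd j (g i l) u - pd l (g i j) u).
Proof.
have E a b : (fun v => metric f v a b) = g a b by apply/funext => v; exact: metricE.
rewrite /christoffel; congr (_ * _); apply: eq_bigr => l _.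
by rewrite -(E j l) -(E i l) -(E i j) unlock.
Qed.

Let christoffelC k i j u : Gam k i j u = Gam k j i u.
Proof.
rewrite !christoffelE; congr (_ * _); apply: eq_bigr => l _; rewrite !pd_g.
by rewrite (pd_comm i j u sf) (dotC (f2 l i u) (f1 j u)) (dotC (f1 i u) (f2 l j u)); ring.
Qed.

(** By [pd_g] the three derivatives of g become six products of a second and a first derivative;
    four cancel by [pd_comm], and the other two are equal, which absorbs the factor 1/2. *)
Let christoffel_g m i j u : \sum_k g m k u * Gam k i j u = dot (f1 m u) (f2 i j u).
Proof.
have E k : Gam k i j u = (invmx (metric f u) *m (\col_l dot (f2 i j u) (f1 l u))) k 0.
  rewrite christoffelE mulr_sumr mxE; apply: eq_bigr => l _; rewrite !pd_g mxE.
  rewrite (pd_comm j i u sf) (pd_comm l i u sf) (pd_comm l j u sf).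
  by rewrite (dotC (f1 j u)) (dotC (f1 i u) (f2 j l u)); field.
under eq_bigr => k _ do rewrite E.
have -> : dot (f1 m u) (f2 i j u) = (\col_l dot (f2 i j u) (f1 l u)) m 0 by rewrite mxE dotC.
have gu : metric f u \in unitmx by rewrite unitmxE unitfE.
set B := \col_l _; transitivity ((metric f u *m (invmx (metric f u) *m B)) m 0).
  2: by rewrite mulKVmx.
by rewrite [RHS]mxE; under [RHS]eq_bigr do rewrite metricE.
Qed.

Let dg i j u : differentiable (g i j) u.
Proof. exact: differentiable_dotv. Qed.

(** Cramer's rule for the 2x2 system [christoffel_g] writes the symbols as quotients of
    differentiable functions by det g. *)
Let differentiable_christoffel k i j u : differentiable (Gam k i j) u.
Proof.
pose c l v := dot (f1 l v) (f2 i j v).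
have dc l v : differentiable (c l) v by exact: differentiable_dotv.
pose D v := g 0 0 v * g 1 1 v - g 0 1 v * g 0 1 v.
have D0 v : D v != 0 by have := detg v; rewrite detE.
have dD : differentiable (fun v => (D v)^-1) u.
  apply: differentiableV; last exact: D0.
  by apply: differentiableB; exact: differentiableM.
have sys m v : g m 0 v * Gam 0 i j v + g m 1 v * Gam 1 i j v = c m v.
  by rewrite -[LHS](sum2E (fun k => g m k v * Gam k i j v)) christoffel_g.
have E0 v : Gam 0 i j v = (g 1 1 v * c 0 v - g 0 1 v * c 1 v) * (D v)^-1.
  by apply: (mulIf (D0 v)); rewrite divfK// -!sys (gC 1 0) /D; ring.
have E1 v : Gam 1 i j v = (g 0 0 v * c 1 v - g 0 1 v * c 0 v) * (D v)^-1.
  by apply: (mulIf (D0 v)); rewrite divfK// -!sys (gC 1 0) /D; ring.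
move: k; apply: ord2P; [rewrite (funext E0)|rewrite (funext E1)];
  by apply: differentiableM => //; apply: differentiableB; exact: differentiableM.
Qed.

(* Differentiating the equations g Gamma = <f_m, f_ij>, which determine the
   Christoffel symbols, avoids differentiating the inverse of g. *)
Let christoffel_pd m i j k u :
  \sum_l (pd k (g m l) u * Gam l i j u + g m l u * pd k (Gam l i j) u) =
  dot (f2 k m u) (f2 i j u) + dot (f1 m u) (f3 k i j u).
Proof.
rewrite -pd_dot//.
have -> : (fun v => dot (f1 m v) (f2 i j v)) = fun v => \sum_l g m l v * Gam l i j v.
  by apply/funext => v; rewrite christoffel_g.
rewrite pd_sum => [|l]; last first.
  exact: (differentiableM (dg _ _ _) (differentiable_christoffel _ _ _ _)).
by apply: eq_bigr => l _; rewrite pdM.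
Qed.

(** The second fundamental form with values in the normal space of [R^n]. For a surface in the
    sphere of [R^4] that space contains the position vector as well as nu. *)
Definition normal_part i j u : 'rV[R]_n := f2 i j u - \sum_l Gam l i j u *: f1 l u.

Lemma normal_part_orth i j m u : dot (f1 m u) (normal_part i j u) = 0.
Proof.
rewrite /normal_part dotBr -christoffel_g !sum2E dotDr !dotZr.
by rewrite mulrC (mulrC (g m 1 u)) subrr.
Qed.

(** Third derivatives enter only through [A1] and [A2], as <f_0, f_011> and <f_0, f_101>, and cancel
    in the difference. The ambient space is the flat [R^n], so the curvature of the sphere itself is
    still hidden in the normal parts. *)
Lemma gauss_equation u : gauss_curvature (metric f) u * \det (metric f u) =
  dot (f2 0 0 u) (normal_part 1 1 u) - dot (f2 0 1 u) (normal_part 0 1 u).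
Proof.
rewrite /gauss_curvature divfK// /normal_part !dotBr !sum2E !dotDr !dotZr !metricE.
have RE l : riemann (metric f) l 0 1 1 u = pd 0 (Gam l 1 1) u - pd 1 (Gam l 0 1) u
    + \sum_m (Gam m 1 1 u * Gam l 0 m u - Gam m 0 1 u * Gam l 1 m u).
  by rewrite unlock.
have s3 : f3 1 0 1 u = f3 0 1 1 u by apply: pd_comm; exact: smooth_pd.
have A1 := christoffel_pd 0 1 1 0 u.
have A2 := christoffel_pd 0 0 1 1 u.
have B i j a : a * (\sum_k g 0 k u * Gam k i j u) = a * dot (f1 0 u) (f2 i j u).
  by rewrite christoffel_g.
(* A linear certificate: the difference of the two sides is the combination of [A1], [A2] and the
   four instances of [B] with signs +, -, +, +, -, -. What remains is a polynomial identity. *)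
have combine (x y a b c d e h a' b' c' d' e' h' : R) : a = a' -> b = b' -> c = c' ->
    d = d' -> e = e' -> h = h' ->
    x - y = a - a' - (b - b') + (c - c') + (d - d') - (e - e') - (h - h') -> x = y.
  move=> -> -> -> -> -> -> /eqP; rewrite !subrr !subr0 !addr0 subr_eq0.
  by move/eqP.
apply: (combine _ _ _ _ _ _ _ _ _ _ _ _ _ _ A1 A2 (B 0 0 (Gam 0 1 1 u))
  (B 0 1 (Gam 1 1 1 u)) (B 1 0 (Gam 0 0 1 u)) (B 1 1 (Gam 1 0 1 u))).
rewrite !RE !sum2E !pd_g s3 (pd_comm 1 0 u sf) (gC 1 0) (christoffelC 1 1 0) (christoffelC 0 1 0).
rewrite (dotC (f2 0 0 u) (f1 0 u)) (dotC (f2 0 0 u) (f1 1 u)) (dotC (f2 0 1 u) (f1 0 u)).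
rewrite (dotC (f2 0 1 u) (f1 1 u)) /g.
move: (pd 0 (Gam 0 1 1) u) (pd 0 (Gam 1 1 1) u) (pd 1 (Gam 0 0 1) u) (pd 1 (Gam 1 0 1) u).
move: (Gam 0 1 1 u) (Gam 1 1 1 u) (Gam 0 0 1 u) (Gam 1 0 1 u) (Gam 0 0 0 u) (Gam 1 0 0 u).
move: (f3 0 1 1 u) (f2 0 0 u) (f2 0 1 u) (f2 1 1 u) (f1 0 u) (f1 1 u) => *.
ring.
Qed.

End GaussEquation.

(** * The left Gauss map in a chart *)

Section CrossProduct.
Variable R : realType.

Definition cross3 (v w : 'rV[R]_3) : 'rV[R]_3 :=
  \row_j [:: v 0 1 * w 0 2%:R - v 0 2%:R * w 0 1;
             v 0 2%:R * w 0 0 - v 0 0 * w 0 2%:R;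
             v 0 0 * w 0 1 - v 0 1 * w 0 0]`_j.

Lemma row3P (v w : 'rV[R]_3) :
  v 0 0 = w 0 0 -> v 0 1 = w 0 1 -> v 0 2%:R = w 0 2%:R -> v = w.
Proof. by move=> h0 h1 h2; apply/rowP; apply: ord3P. Qed.

Lemma row4P (v w : 'rV[R]_4) :
  v 0 0 = w 0 0 -> v 0 1 = w 0 1 -> v 0 2%:R = w 0 2%:R -> v 0 3%:R = w 0 3%:R -> v = w.
Proof. by move=> h0 h1 h2 h3; apply/rowP; apply: ord4P. Qed.

Lemma cross3_orthl v w : dot (cross3 v w) v = 0.
Proof. by rewrite dot3E !mxE /=; ring. Qed.

Lemma cross3_orthr v w : dot (cross3 v w) w = 0.
Proof. by rewrite dot3E !mxE /=; ring. Qed.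

Lemma cross3C v w : cross3 v w = - cross3 w v.
Proof. by apply: row3P; rewrite !mxE /=; ring. Qed.

Lemma cross3vv v : cross3 v v = 0.
Proof. by apply: row3P; rewrite !mxE /=; ring. Qed.

Lemma dot_cross3 v w : dot (cross3 v w) (cross3 v w) = dot v v * dot w w - dot v w ^+ 2.
Proof. by rewrite !dot3E !mxE /=; ring. Qed.

Lemma cross3_lin v w a b c d :
  cross3 (a *: v + b *: w) (c *: v + d *: w) = (a * d - b * c) *: cross3 v w.
Proof. by apply: row3P; rewrite !mxE /=; ring. Qed.

(** A vector orthogonal to [v] and [w] is parallel to their cross product; this is the division-free
    form of that fact. *)
Lemma dot_orth_cross3 v w x y : dot x v = 0 -> dot x w = 0 ->
  dot (cross3 v w) (cross3 v w) * dot x y = dot x (cross3 v w) * dot y (cross3 v w).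
Proof.
move=> xv xw; apply: subr0_eq.
transitivity (dot x v * dot (cross3 (cross3 v w) y) w - dot x w * dot (cross3 (cross3 v w) y) v).
  by rewrite !dot3E !mxE /=; ring.
by rewrite xv xw; ring.
Qed.

Lemma cross3_span v w x : cross3 v w != 0 -> dot x (cross3 v w) = 0 ->
  exists b c, x = b *: v + c *: w.
Proof.
move=> n0 xn; set n := cross3 v w in n0 xn *.
have k0 : dot n n != 0 by rewrite dot_eq0.
(* Cramer's rule: x = b v + c w gives x × w = b n and v × x = c n. *)
exists (dot (cross3 x w) n / dot n n), (dot (cross3 v x) n / dot n n).
apply: (scalerI k0); rewrite scalerDr !scalerA !(mulrC (dot n n)) !divfK//.
apply/eqP; rewrite -subr_eq0; apply/eqP; transitivity (dot x n *: n); last by rewrite xn scale0r.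
by apply: row3P; rewrite /n !dot3E !mxE /=; ring.
Qed.

(** In quaternions [y *m perp_frame p] is - p y, and the imaginary part of a product of imaginary
    quaternions is their cross product. This is where the torsion of the left-invariant frame comes
    from. *)
Lemma perp_frame_cross3 (p : 'rV[R]_4) (x y : 'rV[R]_3) :
  (y *m perp_frame p) *m (perp_frame (x *m perp_frame p))^T = dot p p *: cross3 x y.
Proof.
have E k q : (y *m perp_frame p *m (perp_frame q)^T) 0 k =
    dot (y *m perp_frame p) (row k (perp_frame q)).
  by rewrite mxE; apply: eq_bigr => j _; rewrite !mxE.
by apply: row3P; rewrite E !dot4E !mxE /= !sum3E !mxE /=; ring.
Qed.

End CrossProduct.

Section RowConvergence.
Context (R : realType) (T : Type) (F : set_system T) {FF : Filter F}.

Lemma cvg_rowP n (f : T -> 'rV[R]_n) (l : 'rV[R]_n) :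
  f @ F --> l <-> forall j, f x 0 j @[x --> F] --> l 0 j.
Proof.
split=> [fl j|fl].
  exact: (cvg_comp f (fun v : 'rV[R]_n => v 0 j) fl (@coord_continuous _ _ _ 0 j l)).
apply/cvgrPdist_lt => e e0; near=> x.
rewrite /Num.Def.normr/= mx_normrE; apply/bigmax_ltP; split=> // -[i j] _ /=.
rewrite !mxE ord1; move: j; near: x; apply: filter_forall => j.
exact: ((cvgrPdist_lt _ _).1 (fl j)).
Unshelve. all: by end_near. Qed.

Lemma cvg_dot n (f g : T -> 'rV[R]_n) (l m : 'rV[R]_n) :
  f @ F --> l -> g @ F --> m -> dot (f x) (g x) @[x --> F] --> dot l m.
Proof.
move=> /cvg_rowP fl /cvg_rowP gm; rewrite /dot.
by apply: cvg_big => [|j _]; [exact: add_continuous|exact: cvgM].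
Qed.

Lemma cvg_mulmx_cst m n (f : T -> 'rV[R]_m) (l : 'rV[R]_m) (A : 'M[R]_(m, n)) :
  f @ F --> l -> f x *m A @[x --> F] --> l *m A.
Proof.
move=> fl; apply/cvg_rowP => j; under eq_fun do rewrite mulmx_dot.
by rewrite mulmx_dot; apply: cvg_dot => //; exact: cvg_cst.
Qed.

Lemma cvg_cross3 (f g : T -> 'rV[R]_3) (l m : 'rV[R]_3) :
  f @ F --> l -> g @ F --> m -> cross3 (f x) (g x) @[x --> F] --> cross3 l m.
Proof.
move=> /cvg_rowP fl /cvg_rowP gm; apply/cvg_rowP; apply: ord3P;
  under eq_fun do rewrite mxE /=; rewrite mxE /=; apply: cvgB; exact: cvgM.
Qed.

End RowConvergence.

Section CrossProductCalculus.
Variables (R : realType) (a b : 'rV[R]_2 -> 'rV[R]_3) (u : 'rV[R]_2).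
Hypotheses (da : differentiable a u) (db : differentiable b u).

Lemma differentiable_cross3 : differentiable (fun v => cross3 (a v) (b v)) u.
Proof.
have da' := (differentiable_rowP a u).1 da; have db' := (differentiable_rowP b u).1 db.
apply/differentiable_rowP; apply: ord3P; under eq_fun do rewrite mxE /=;
  by apply: differentiableB; apply: differentiableM.
Qed.

Lemma pd_cross3 i : pd i (fun v => cross3 (a v) (b v)) u =
  cross3 (pd i a u) (b u) + cross3 (a u) (pd i b u).
Proof.
have da' := (differentiable_rowP a u).1 da; have db' := (differentiable_rowP b u).1 db.
have pB (h k : 'rV[R]_2 -> R) : differentiable h u -> differentiable k u ->
    pd i (fun v => h v - k v) u = pd i h u - pd i k u.
  by move=> dh dk; rewrite unlock; apply: deriveB; exact: diff_derivable.
apply/rowP => k; rewrite (pd_row _ _ differentiable_cross3); move: k.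
apply: ord3P; under eq_fun do rewrite mxE /=; rewrite !mxE /=;
  (rewrite pB; [|exact: differentiableM..]);
  by rewrite !(pdM _ (da' _) (db' _)) !pd_row//; ring.
Qed.

End CrossProductCalculus.

(** [perp_frame] is linear in its point, and this matrix produces its row [k]. Coordinates in the
    moving frame thus become dot products, within reach of [pd_dot] and [cvg_dot]. *)
Definition frame_slice (R : realType) k : 'M[R]_4 := \matrix_i row k (perp_frame (delta_mx 0 i)).

Lemma row_perp_frame (R : realType) k (q : 'rV[R]_4) :
  row k (perp_frame q) = q *m frame_slice R k.
Proof.
rewrite mulmx_sum_row {1}perp_frame_lin; apply/rowP => j; rewrite mxE !summxE.
by apply: eq_bigr => i _; rewrite !mxE.
Qed.

Lemma mulmx_perp_frame (R : realType) (v p : 'rV[R]_4) k :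
  (v *m (perp_frame p)^T) 0 k = dot v (p *m frame_slice R k).
Proof. by rewrite mulmx_dot trmxK row_perp_frame. Qed.

Lemma cvg_mulmx_perp (R : realType) (T : Type) (F : set_system T) {FF : Filter F}
    (v f : T -> 'rV[R]_4) (w p : 'rV[R]_4) : v @ F --> w -> f @ F --> p ->
  v x *m (perp_frame (f x))^T @[x --> F] --> w *m (perp_frame p)^T.
Proof.
move=> vw fp; apply/cvg_rowP => k; under eq_fun do rewrite mulmx_perp_frame.
by rewrite mulmx_perp_frame; apply: cvg_dot => //; exact: cvg_mulmx_cst.
Qed.

(** * The left Gauss map of a patch and its Jacobian *)

Section LeftGaussMap.
Variables (R : realType) (f : 'rV[R]_2 -> 'rV[R]_4).

(* The imaginary part of f^-1 d_i f, up to sign. *)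
Definition left_form i u : 'rV[R]_3 := pd i f u *m (perp_frame (f u))^T.

(** Coordinates of a positive multiple of nu. The order 1, 0 is a matter of orientation:
    [perp_frame p] followed by p is a positive basis of [R^4], so p followed by [perp_frame p] is a
    negative one, whereas (f, d_0 f, d_1 f, nu) has to be positive. *)
Definition left_normal u : 'rV[R]_3 := cross3 (left_form 1 u) (left_form 0 u).

Definition left_gauss u : 'rV[R]_3 :=
  (Num.sqrt (dot (left_normal u) (left_normal u)))^-1 *: left_normal u.

Hypothesis sf : smooth f.
Hypothesis f1 : forall u, dot (f u) (f u) = 1.
Hypothesis detg : forall u, \det (metric f u) != 0.
Hypothesis Kpos : forall u, 0 < gauss_curvature (metric f) u.

Let d0 u : differentiable f u. Proof. exact: smooth_diff. Qed.
Let d1 i u : differentiable (pd i f) u. Proof. by apply: smooth_diff; exact: smooth_pd. Qed.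
Let d2 i j u : differentiable (pd i (pd j f)) u.
Proof. by apply: smooth_diff; do 2!apply: smooth_pd. Qed.

Let metric_pd i j u : metric f u i j = dot (pd i f u) (pd j f u).
Proof. by rewrite mxE unlock. Qed.

Lemma sphere_tangent i u : dot (f u) (pd i f u) = 0.
Proof.
have : pd i (fun v => dot (f v) (f v)) u = 0.
  by rewrite (_ : (fun v => _) = fun=> 1) ?pd_cst//; apply/funext => v; rewrite f1.
rewrite pd_dot// dotC -mulr2n => /eqP.
by rewrite mulrn_eq0 => /eqP.
Qed.

Lemma sphere_second i j u : dot (f u) (pd i (pd j f) u) = - metric f u i j.
Proof.
have : pd i (fun v => dot (f v) (pd j f v)) u = 0.
  by rewrite (_ : (fun v => _) = fun=> 0) ?pd_cst//; apply/funext => v; rewrite sphere_tangent.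
by rewrite pd_dot// metric_pd => /eqP; rewrite addrC addr_eq0 => /eqP.
Qed.

Lemma left_formK i u : left_form i u *m perp_frame (f u) = pd i f u.
Proof.
rewrite /left_form -mulmxA perp_frame_compl f1 mulmxBr mulmx1 mulmxA.
have -> : pd i f u *m (f u)^T = 0.
  by apply/matrixP => a b; rewrite !ord1 -dotE dotC sphere_tangent mxE.
by rewrite mul0mx subr0.
Qed.

Lemma dot_perp_frame m n (v : 'rV[R]_m) (w : 'rV[R]_n) (A : 'M[R]_(m, n)) :
  dot (v *m A) w = dot v (w *m A^T).
Proof. by rewrite !dotE trmx_mul trmxK mulmxA. Qed.

Lemma dot_left_form i j u : dot (left_form i u) (left_form j u) = metric f u i j.
Proof. by rewrite -[LHS]dot_perp_frame left_formK metric_pd. Qed.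

Lemma dot_left_normal u : dot (left_normal u) (left_normal u) = \det (metric f u).
Proof.
rewrite dot_cross3 !dot_left_form det_mx2 [metric f u 1 0]metric_pd dotC -metric_pd.
by ring.
Qed.

Lemma left_normal_neq0 u : left_normal u != 0.
Proof. by rewrite -dot_eq0 dot_left_normal. Qed.

Lemma left_normal_orth i u : dot (left_normal u) (left_form i u) = 0.
Proof. by move: i; apply: ord2P; rewrite ?cross3_orthr ?cross3_orthl. Qed.

Lemma differentiable_left_form i u : differentiable (left_form i) u.
Proof.
apply/differentiable_rowP => k; under eq_fun do rewrite [left_form _ _]/left_form mulmx_perp_frame.
by apply: differentiable_dotv => //; exact: differentiable_mulmx.
Qed.

(** Product rule; the cross product is the derivative of the moving frame. Being antisymmetric in
    [i] and [j], it adds a rotation to the symmetric second fundamental form. *)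
Lemma pd_left_form i j u : pd i (left_form j) u =
  pd i (pd j f) u *m (perp_frame (f u))^T + cross3 (left_form i u) (left_form j u).
Proof.
have -> : cross3 (left_form i u) (left_form j u) =
    pd j f u *m (perp_frame (pd i f u))^T.
  by rewrite -[in RHS](left_formK i) -[in RHS](left_formK j) perp_frame_cross3 f1 scale1r.
apply/rowP => k; rewrite pd_row; last exact: differentiable_left_form.
under eq_fun do rewrite [left_form _ _]/left_form mulmx_perp_frame.
rewrite pd_dot//; last exact: differentiable_mulmx.
by rewrite pd_mulmx// -!mulmx_perp_frame [RHS]mxE.
Qed.

(* Up to the factor |left_normal|, the second fundamental form plus the
   antisymmetric contribution of the torsion of the left-invariant connection. *)
Definition left_second i j u := dot (left_normal u) (pd i (left_form j) u).

(** The matrix is H with - D and + D added to its (0, 1) and (1, 0) entries, so its determinant is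
    det H + D^2. The Gauss equation multiplied by D says the same of K D^2. This is det (A + J) = 1
    + det A before normalisation. *)
Lemma left_second_det u :
  left_second 0 0 u * left_second 1 1 u - left_second 0 1 u * left_second 1 0 u =
  gauss_curvature (metric f) u * \det (metric f u) ^+ 2.
Proof.
set n := left_normal u; set D := \det (metric f u).
pose H i j := dot (n *m perp_frame (f u)) (pd i (pd j f) u).
have nn : dot n n = D := dot_left_normal u.
have LE i j : left_second i j u = H i j + dot n (cross3 (left_form i u) (left_form j u)).
  by rewrite /left_second pd_left_form dotDr -dot_perp_frame.
have c10 : dot n (cross3 (left_form 1 u) (left_form 0 u)) = D by rewrite -nn.
have c01 : dot n (cross3 (left_form 0 u) (left_form 1 u)) = - D.
  by rewrite cross3C dotC dotNl dotC c10.
have H10 : H 1 0 = H 0 1 by rewrite /H pd_comm.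
have D0 : D != 0 := detg u.
(* Expanding in the orthogonal directions f and nu: [normal_part] has component - g_kl along f,
   which accounts for the curvature 1 of [S^3], and the component along [left_normal] gives the
   product of the two entries of [H]. *)
have key i j k l : D * dot (pd i (pd j f) u) (normal_part f k l u) =
    D * (metric f u i j * metric f u k l) + H i j * H k l.
  set v := normal_part f k l u.
  have vf m : dot (pd m f u) v = 0 by exact: normal_part_orth.
  have fv : dot (f u) v = - metric f u k l.
    rewrite /v /normal_part dotBr sum2E dotDr !dotZr !sphere_tangent !mulr0 addr0 subr0.
    exact: sphere_second.
  have nv : dot (n *m perp_frame (f u)) v = H k l.
    have nf m : dot (n *m perp_frame (f u)) (pd m f u) = 0.
      by rewrite dot_perp_frame; exact: left_normal_orth.
    by rewrite /v /normal_part dotBr sum2E dotDr !dotZr !nf !mulr0 addr0 subr0.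
  have va m : dot (v *m (perp_frame (f u))^T) (left_form m u) = 0.
    by rewrite dotC -dot_perp_frame left_formK vf.
  set w := pd i (pd j f) u.
  have E : dot w v = dot (f u) w * dot (f u) v +
      dot (v *m (perp_frame (f u))^T) (w *m (perp_frame (f u))^T).
    rewrite -[X in _ + X]dot_perp_frame -mulmxA perp_frame_compl f1 mulmxBr mulmx1.
    rewrite dotBl (dotC v w) mulmxA.
    have -> : v *m (f u)^T = (dot v (f u))%:M.
      by apply/matrixP => a b; rewrite !ord1 -dotE mxE.
    by rewrite mul_scalar_mx dotZl (dotC v); ring.
  rewrite E mulrDr fv sphere_second mulrNN -nn dot_orth_cross3 ?va//.
  congr (_ + _); rewrite -/(left_normal u) -/n mulrC.
  by congr (_ * _); rewrite dotC -dot_perp_frame.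
have aux (k d a b : R) : k * d = a - b -> k * d ^+ 2 = d * a - d * b.
  by move=> E; rewrite expr2 mulrA E; ring.
apply: etrans _ (esym (aux _ _ _ _ (gauss_equation sf detg u))).
apply: etrans _ (esym (congr2 (fun a b => a - b) (key 0 0 1 1) (key 0 1 0 1))).
rewrite (LE 0 0) (LE 1 1) (LE 0 1) (LE 1 0) !cross3vv (dotC n 0) dot0l c10 c01 H10.
have : D = metric f u 0 0 * metric f u 1 1 - metric f u 0 1 * metric f u 0 1.
  by rewrite /D det_mx2 [metric f u 1 0]metric_pd dotC -metric_pd.
clearbody D; move: (H 0 0) (H 1 1) (H 0 1) (metric f u 0 0) (metric f u 1 1) (metric f u 0 1).
move=> a b c x y z DE; transitivity (D * D + a * b - c * c); first by ring.
by rewrite {2}DE; ring.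
Qed.

Lemma continuous_pd_left_form i j : continuous (pd i (left_form j)).
Proof.
move=> u; rewrite (funext (pd_left_form i j)).
have c0 : f x @[x --> u] --> f u by apply: differentiable_continuous.
have cl k : left_form k x @[x --> u] --> left_form k u.
  by apply: differentiable_continuous; exact: differentiable_left_form.
have c2 : pd i (pd j f) x @[x --> u] --> pd i (pd j f) u.
  exact: differentiable_continuous.
exact: cvgD (cvg_mulmx_perp c2 c0) (cvg_cross3 (cl i) (cl j)).
Qed.

Lemma differentiable_left_normal u : differentiable left_normal u.
Proof. by apply: differentiable_cross3; exact: differentiable_left_form. Qed.

Lemma pd_left_normal i u : pd i left_normal u =
  cross3 (pd i (left_form 1) u) (left_form 0 u) + cross3 (left_form 1 u) (pd i (left_form 0) u).
Proof. by apply: pd_cross3; exact: differentiable_left_form. Qed.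

Lemma continuous_pd_left_normal i : continuous (pd i left_normal).
Proof.
move=> u; rewrite (funext (pd_left_normal i)).
have cl k : left_form k x @[x --> u] --> left_form k u.
  by apply: differentiable_continuous; exact: differentiable_left_form.
have cp k := @continuous_pd_left_form i k u.
exact: cvgD (cvg_cross3 (cp 1) (cl 0)) (cvg_cross3 (cl 1) (cp 0)).
Qed.

Lemma pd_left_normal_form i j u :
  dot (pd i left_normal u) (left_form j u) = - left_second i j u.
Proof.
have : pd i (fun v => dot (left_normal v) (left_form j v)) u = 0.
  by rewrite (_ : (fun v => _) = fun=> 0) ?pd_cst//; apply/funext => v; exact: left_normal_orth.
rewrite pd_dot; [|exact: differentiable_left_normal|exact: differentiable_left_form].
by move=> /eqP; rewrite addr_eq0 => /eqP.
Qed.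

Let nn_gt0 u : 0 < dot (left_normal u) (left_normal u).
Proof. by rewrite lt_def dot_ge0 dot_eq0 left_normal_neq0. Qed.

Let s u := (Num.sqrt (dot (left_normal u) (left_normal u)))^-1.

Let s_gt0 u : 0 < s u. Proof. by rewrite invr_gt0 sqrtr_gt0. Qed.

Lemma left_gauss_unit u : dot (left_gauss u) (left_gauss u) = 1.
Proof.
rewrite /left_gauss dotZl dotZr mulrA -expr2 exprVn sqr_sqrtr ?dot_ge0//.
by rewrite mulVf// gt_eqF.
Qed.

Lemma left_gauss_orth j u : dot (left_gauss u) (left_form j u) = 0.
Proof. by rewrite dotZl left_normal_orth mulr0. Qed.

Lemma differentiable_left_gauss u : differentiable left_gauss u.
Proof.
have dn := differentiable_left_normal u.
apply/differentiable_rowP => j; under eq_fun do rewrite mxE.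
apply: differentiableM; last by move: j; apply/differentiable_rowP.
apply: differentiableV; last by rewrite sqrtr_eq0 -ltNge.
apply: (@differentiable_comp _ _ _ _ (fun v => dot (left_normal v) (left_normal v)) Num.sqrt).
  exact: differentiable_dotv.
apply/derivable1_diffP; exact: (@ex_derive _ _ _ _ _ _ _ (is_derive1_sqrt (nn_gt0 u))).
Qed.

Lemma pd_left_gauss_form i j u :
  dot (pd i left_gauss u) (left_form j u) = - (s u * left_second i j u).
Proof.
have : pd i (fun v => dot (left_gauss v) (left_form j v)) u = 0.
  by rewrite (_ : (fun v => _) = fun=> 0) ?pd_cst//; apply/funext => v; exact: left_gauss_orth.
rewrite pd_dot; [|exact: differentiable_left_gauss|exact: differentiable_left_form].
by move=> /eqP; rewrite addr_eq0 => /eqP ->; rewrite dotZl.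
Qed.

Lemma pd_left_gauss_orth i u : dot (pd i left_gauss u) (left_gauss u) = 0.
Proof.
have : pd i (fun v => dot (left_gauss v) (left_gauss v)) u = 0.
  by rewrite (_ : (fun v => _) = fun=> 1) ?pd_cst//; apply/funext => v; exact: left_gauss_unit.
rewrite pd_dot; [|exact: differentiable_left_gauss..].
by rewrite (dotC (left_gauss u)) -mulr2n => /eqP; rewrite mulrn_eq0 => /eqP.
Qed.

Lemma left_second_det_gt0 u :
  0 < left_second 0 0 u * left_second 1 1 u - left_second 0 1 u * left_second 1 0 u.
Proof. by rewrite left_second_det mulr_gt0// exprn_even_gt0//= detg orbT. Qed.

(* Only y = left_gauss u and its antipode make <left_gauss, y> critical at u. *)
Lemma left_gauss_critical u y : dot y y = 1 -> 0 < dot (left_gauss u) y ->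
  (forall i, dot (pd i left_gauss u) y = 0) -> left_gauss u = y.
Proof.
move=> yy Gy dy; set g := left_gauss u in Gy *.
(* The component of [y] tangent to the sphere at [g] lies in the span of the left forms; criticality
   says that [left_second] annihilates its coordinates [b] and [c]. *)
pose y' := y - dot g y *: g.
have y'n : dot y' (left_normal u) = 0.
  have -> : left_normal u = (s u)^-1 *: g by rewrite scalerA mulVf ?scale1r ?gt_eqF.
  by rewrite dotZr dotBl dotZl left_gauss_unit mulr1 (dotC y) subrr mulr0.
have [b [c y'E]] := cross3_span (left_normal_neq0 u) y'n.
have sys i : b * left_second i 1 u + c * left_second i 0 u = 0.
  have : dot (pd i left_gauss u) y' = 0.
    by rewrite dotBr dotZr pd_left_gauss_orth mulr0 dy subrr.
  rewrite y'E dotDr !dotZr !pd_left_gauss_form !mulrN !(mulrCA _ (s u)) -opprD -mulrDr.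
  by move/eqP; rewrite oppr_eq0 mulf_eq0 gt_eqF//= => /eqP.
have D0 := lt0r_neq0 (left_second_det_gt0 u).
have b0 : b = 0.
  apply: (mulfI D0); rewrite mulr0.
  transitivity (left_second 0 0 u * (b * left_second 1 1 u + c * left_second 1 0 u)
    - left_second 1 0 u * (b * left_second 0 1 u + c * left_second 0 0 u)); first ring.
  by rewrite !sys !mulr0 subrr.
have c0 : c = 0.
  apply: (mulfI D0); rewrite mulr0.
  transitivity (left_second 1 1 u * (b * left_second 0 1 u + c * left_second 0 0 u)
    - left_second 0 1 u * (b * left_second 1 1 u + c * left_second 1 0 u)); first ring.
  by rewrite !sys !mulr0 subrr.
have yE : y = dot g y *: g.
  by apply/eqP; rewrite -subr_eq0 -/y' y'E b0 c0 !scale0r addr0.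
have : dot g y ^+ 2 = 1.
  by rewrite -[RHS]yy {2 3}yE dotZl dotZr left_gauss_unit mulr1 expr2.
by move=> /eqP; rewrite sqrp_eq1 ?ltW// => /eqP gy; rewrite yE gy scale1r.
Qed.

Let derive_pd (h : 'rV[R]_2 -> R) (d u : 'rV[R]_2) : differentiable h u ->
  'D_d h u = d 0 0 * pd 0 h u + d 0 1 * pd 1 h u.
Proof.
move=> dh; rewrite unlock /partial !deriveE// {1}(row_sum_delta d) linear_sum sum2E.
by rewrite !linearZ.
Qed.

(* If left_gauss v = left_gauss w, then the functions <left_normal, left_form j v>
   vanish at v and w; the mean value theorem for j = 0, 1 gives a linear system
   for w - v whose determinant is close to that of left_second. *)
Lemma left_gauss_locally_injective u : exists2 e : R, 0 < e &
  forall v w, ball u e v -> ball u e w -> left_gauss v = left_gauss w -> v = w.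
Proof.
pose P i j (z v : 'rV[R]_2) := dot (pd i left_normal z) (left_form j v).
(* The mean value theorem gives a different intermediate point for each [j], so the two columns are
   evaluated at independent points [z0] and [z1]; continuity at (u, u, u) still makes the
   determinant nonzero. *)
pose D (z0 z1 v : 'rV[R]_2) := P 0 0 z0 v * P 1 1 z1 v - P 1 0 z0 v * P 0 1 z1 v.
have cD : D z.1.1 z.1.2 z.2 @[z --> (u, u, u)] --> D u u u.
  have c1 : z.1.1 @[z --> (u, u, u)] --> u by apply: cvg_comp cvg_fst cvg_fst.
  have c2 : z.1.2 @[z --> (u, u, u)] --> u by apply: cvg_comp cvg_fst cvg_snd.
  have c3 : z.2 @[z --> (u, u, u)] --> u by exact: cvg_snd.
  have cP i j (h : 'rV[R]_2 * 'rV[R]_2 * 'rV[R]_2 -> 'rV[R]_2) :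
      h z @[z --> (u, u, u)] --> u -> P i j (h z) z.2 @[z --> (u, u, u)] --> P i j u u.
    move=> ch; apply: cvg_dot.
      by apply: (cvg_comp _ (pd i left_normal) ch); exact: continuous_pd_left_normal.
    apply: (cvg_comp _ (left_form j) c3).
    by apply: differentiable_continuous; exact: differentiable_left_form.
  by apply: cvgB; apply: cvgM; exact: cP.
have D0 : D u u u != 0.
  rewrite /D /P !pd_left_normal_form !mulrNN.
  by rewrite [X in _ - X]mulrC; exact: lt0r_neq0 (left_second_det_gt0 u).
have [[A B] [/= [[A1 A2] [/= nA1 nA2 A12]] nB AB]] :
    \forall z \near (u, u, u), D z.1.1 z.1.2 z.2 != 0.
  exact: cvgr_neq0 cD D0.
have /nbhs_ballP[e /= e0 eP] : nbhs u (A1 `&` A2 `&` B) by do 2!apply: filterI => //.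
exists e => // v w uv uw Gvw.
have mid t : 0 < t < 1 -> (A1 `&` A2 `&` B) (v + t *: (w - v)).
  move=> /andP[t0 t1]; apply: eP; move: uv uw; rewrite -!ball_normE /= => uv uw.
  have -> : u - (v + t *: (w - v)) = (1 - t) *: (u - v) + t *: (u - w).
    apply/rowP => k; rewrite !mxE; ring.
  apply: le_lt_trans (ler_normD _ _) _; rewrite !normrZ !gtr0_norm ?subr_gt0//.
  rewrite -[ltRHS](subrK (t * e)) -{1}[e]mul1r -mulrBl.
  by apply: ltrD; rewrite ltr_pM2l// subr_gt0.
have Bv : B v by apply: (eP v uv).2.
have mvt j : exists2 z, (A1 `&` A2 `&` B) z &
    (w - v) 0 0 * P 0 j z v + (w - v) 0 1 * P 1 j z v = 0.
  have dh z : differentiable (fun z => dot (left_normal z) (left_form j v)) z.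
    apply: differentiable_dotv; first exact: differentiable_left_normal.
    exact: differentiable_cst.
  have [t t01] := line_MVT v (w - v) dh ltr01.
  rewrite scale1r [v + (w - v)]addrC subrK mul1r left_normal_orth subr0 (derive_pd _ (dh _)).
  have -> : dot (left_normal w) (left_form j v) = 0.
    have -> : left_normal w = (s w)^-1 *: left_gauss w.
      by rewrite scalerA mulVf ?scale1r ?gt_eqF.
    by rewrite -Gvw dotZl left_gauss_orth mulr0.
  move=> E; exists (v + t *: (w - v)); first exact: mid.
  rewrite [RHS]E !pd_dot ?pd_cst; try exact: differentiable_left_normal;
    try exact: differentiable_cst.
  by rewrite !(dotC (left_normal _) 0) !dot0l !addr0.
have [z0 [[A1z0 _] _] E0] := mvt 0; have [z1 [[_ A2z1] _] E1] := mvt 1.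
have Dz : D z0 z1 v != 0 by apply: (AB (z0, z1, v)); split => //; exact: A12 (z0, z1) (conj _ _).
have q0 : (w - v) 0 0 = 0.
  apply: (mulfI Dz); rewrite mulr0 /D.
  transitivity (P 1 1 z1 v * ((w - v) 0 0 * P 0 0 z0 v + (w - v) 0 1 * P 1 0 z0 v)
    - P 1 0 z0 v * ((w - v) 0 0 * P 0 1 z1 v + (w - v) 0 1 * P 1 1 z1 v)); first ring.
  by rewrite E0 E1 !mulr0 subrr.
have q1 : (w - v) 0 1 = 0.
  apply: (mulfI Dz); rewrite mulr0 /D.
  transitivity (P 0 0 z0 v * ((w - v) 0 0 * P 0 1 z1 v + (w - v) 0 1 * P 1 1 z1 v)
    - P 0 1 z1 v * ((w - v) 0 0 * P 0 0 z0 v + (w - v) 0 1 * P 1 0 z0 v)); first ring.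
  by rewrite E0 E1 !mulr0 subrr.
apply/esym/eqP; rewrite -subr_eq0; apply/eqP/rowP; apply: ord2P; by rewrite ?q0 ?q1 mxE.
Qed.

End LeftGaussMap.

(** * Stereographic charts *)

Section StereographicProjection.
Variable R : realType.
Local Notation S2 := (sphere R 2).
Implicit Types (u v : 'rV[R]_2) (y z : S2).

Lemma sphere_unit n (x : sphere R n) : dot (set_val x) (set_val x) = 1.
Proof. exact: (set_mem (valP x)). Qed.

(** The norm on rows is the maximum norm, bounded by the Euclidean one. Estimates on spheres are
    computed with [dot] and transferred here. *)
Lemma norm_lt_dot n (v : 'rV[R]_n) (e : R) : 0 < e -> dot v v < e ^+ 2 -> `|v| < e.
Proof.
move=> e0 ve; rewrite /Num.Def.normr/= mx_normrE; apply/bigmax_ltP; split => // -[i j] _ /=.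
rewrite ord1 -(ltr_pXn2r (n := 2))// ?nnegrE ?(ltW e0)//.
apply: le_lt_trans ve; rewrite real_normK ?num_real// /dot (bigD1 j)//= expr2 lerDl.
by apply: sumr_ge0 => k _; rewrite -expr2 sqr_ge0.
Qed.

Definition pole_sign (b : bool) : R := (-1) ^+ b.

Lemma pole_signK b : pole_sign b * pole_sign b = 1.
Proof. by rewrite -expr2 sqrr_sign. Qed.

(* Inverse of stereo_pt b; at the missing pole it is 0, as x / 0 = 0. *)
Definition unstereo (b : bool) (y : 'rV[R]_3) : 'rV[R]_2 :=
  (1 + pole_sign b * y 0 2%:R)^-1 *: \row_j [:: y 0 0; pole_sign b * y 0 1]`_j.

Lemma row2P (v w : 'rV[R]_2) : v 0 0 = w 0 0 -> v 0 1 = w 0 1 -> v = w.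
Proof. by move=> h0 h1; apply/rowP; apply: ord2P. Qed.

Let stereo0 b u : stereo_pt b u 0 0 = 2 * u 0 0 / (1 + dot u u).
Proof. by rewrite mxE. Qed.

Let stereo1 b u : stereo_pt b u 0 1 = pole_sign b * (2 * u 0 1 / (1 + dot u u)).
Proof. by rewrite mxE. Qed.

Let stereo2 b u : stereo_pt b u 0 2%:R = pole_sign b * ((1 - dot u u) / (1 + dot u u)).
Proof. by rewrite mxE. Qed.

Lemma stereo_pole b u : 1 + pole_sign b * (stereo_pt b u) 0 2%:R = 2 / (1 + dot u u).
Proof.
have h := onep_dot_neq0 u; rewrite stereo2 mulrA pole_signK; field.
exact: h.
Qed.

Lemma stereo_pole_neq0 b u : 1 + pole_sign b * (stereo_pt b u) 0 2%:R != 0.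
Proof. by rewrite stereo_pole mulf_neq0 ?invr_eq0 ?onep_dot_neq0// pnatr_eq0. Qed.

Lemma stereoK b u : unstereo b (stereo_pt b u) = u.
Proof.
have h := onep_dot_neq0 u; have p1 := pole_signK b.
have t2 : (2 : R) != 0 by rewrite pnatr_eq0.
rewrite /unstereo stereo_pole; apply: row2P; rewrite 2!mxE /= ?stereo0 ?stereo1.
  by field; rewrite ?h ?t2.
by rewrite mulrA p1; field; rewrite ?h ?t2.
Qed.

Lemma unstereoK b (y : 'rV[R]_3) : dot y y = 1 -> 1 + pole_sign b * y 0 2%:R != 0 ->
  stereo_pt b (unstereo b y) = y.
Proof.
move=> yy h; set c := 1 + _ in h.
have E : dot (unstereo b y) (unstereo b y) = (2 - c) / c.
  rewrite /unstereo -/c dotZl dotZr dot2E !mxE /= mulrA.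
  have -> : pole_sign b * y 0 1 * (pole_sign b * y 0 1) = y 0 1 * y 0 1.
    by rewrite mulrACA pole_signK mul1r.
  have -> : y 0 0 * y 0 0 + y 0 1 * y 0 1 = (2 - c) * c.
    have -> : (2 - c) * c = 1 - (pole_sign b * pole_sign b) * (y 0 2%:R * y 0 2%:R).
      by rewrite /c; ring.
    by rewrite pole_signK mul1r -yy dot3E; ring.
  by field.
have E1 : 1 + dot (unstereo b y) (unstereo b y) = 2 / c by rewrite E; field.
have E2 : 1 - dot (unstereo b y) (unstereo b y) = 2 * (c - 1) / c by rewrite E; field.
have t2 : (2 : R) != 0 by rewrite pnatr_eq0.
apply: row3P; rewrite ?stereo0 ?stereo1 ?stereo2 E1 ?E2 /unstereo -/c ?mxE /=.
- by field; rewrite ?h ?t2.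
- transitivity (pole_sign b * pole_sign b * y 0 1); last first.
    by rewrite pole_signK mul1r.
  by field; rewrite ?h ?t2.
- transitivity (pole_sign b * pole_sign b * y 0 2%:R); last first.
    by rewrite pole_signK mul1r.
  have -> : c - 1 = pole_sign b * y 0 2%:R by rewrite /c; ring.
  by field; rewrite ?h ?t2.
Qed.

Lemma differentiable_unstereo b (y : 'rV[R]_3) :
  1 + pole_sign b * y 0 2%:R != 0 -> differentiable (unstereo b) y.
Proof.
move=> y0; have dc j : differentiable (fun x : 'rV[R]_3 => x 0 j) y.
  exact: differentiable_coord.
have di : differentiable (fun x : 'rV[R]_3 => (1 + pole_sign b * x 0 2%:R)^-1) y.
  apply: differentiableV => //; apply: differentiableD => //.
  by apply: differentiableM.
apply/differentiable_rowP; apply: ord2P; under eq_fun do rewrite 2!mxE /=;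
  apply: differentiableM => //.
by apply: differentiableM.
Qed.

(** The chordal distance formula. The denominator is at least 1, so each chart is 2-Lipschitz for
    the Euclidean distance. *)
Lemma stereo_dist b u v :
  dot (stereo_pt b u - stereo_pt b v) (stereo_pt b u - stereo_pt b v) =
  4 * dot (u - v) (u - v) / ((1 + dot u u) * (1 + dot v v)).
Proof.
have := onep_dot_neq0 u; have := onep_dot_neq0 v.
have ss := pole_signK b; move: ss.
rewrite dot3E !mxE /= -/(pole_sign b) !dot2E !mxE; set s := pole_sign b => ss hu hv.
have sq (a a' : R) : (s * a - s * a') * (s * a - s * a') = (a - a') * (a - a').
  by rewrite -mulrBr mulrACA ss mul1r.
by rewrite !sq; field; rewrite hu hv.
Qed.

Definition north : 'rV[R]_3 := stereo_pt false 0.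

(** The sign of the third coordinate selects the chart in which the hemisphere of [z] is the closed
    unit disc. The bound on [u] provides a compact parameter domain for [retract_continuous]. *)
Lemma stereo_surj (z : S2) : exists b u, z = stereo b u /\ dot u u <= 1.
Proof.
have zz := sphere_unit z; set y := set_val z in zz.
have [b yb] : exists b, 0 <= pole_sign b * y 0 2%:R.
  have [y0|y0] := lerP 0 (y 0 2%:R); first by exists false; rewrite /pole_sign expr0 mul1r.
  by exists true; rewrite /pole_sign expr1 mulN1r oppr_ge0 ltW.
have c0 : 0 < 1 + pole_sign b * y 0 2%:R by rewrite ltr_pwDl.
have yE := unstereoK zz (lt0r_neq0 c0).
exists b, (unstereo b y); split; first by apply: val_inj; rewrite /= yE.
have := stereo_pole b (unstereo b y); rewrite yE => E.
have := onep_dot_gt0 (unstereo b y) => h.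
rewrite -(lerD2l 1) -[leRHS]/(2 : R) -[leLHS]mul1r -ler_pdivlMr//.
by rewrite -E lerDl.
Qed.

End StereographicProjection.

(** * Local homeomorphisms of the sphere are bijective *)

Lemma finite_set_notin (R : realType) (A : set R) : finite_set A -> exists x, ~ A x.
Proof.
move=> /finite_seqP[s ->]; exists (1 + \sum_(y <- s) `|y|) => /= xs.
have := le_refl (\sum_(y <- s) `|y|); rewrite [leLHS](big_rem _ xs)/=.
have h : 0 <= \sum_(y <- s) `|y| by apply: sumr_ge0.
have h' : 0 <= \sum_(y <- rem (1 + \sum_(y <- s) `|y|) s) `|y| by apply: sumr_ge0.
rewrite ger0_norm; last by rewrite addr_ge0.
by apply/negP; rewrite -ltNge -addrA addrCA ltr_pwDr// ltr_pwDl.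
Qed.

Lemma sphere_compact (R : realType) n : compact (sphere R n : set 'rV[R]_n.+1).
Proof.
apply: bounded_closed_compact.
  exists 1; split; first exact: num_real.
  move=> M M1 x /= xx; apply: ltW; apply: norm_lt_dot; first exact: lt_trans M1.
  by rewrite xx exprn_egt1// ltW.
have -> : sphere R n = (fun x => dot x x) @^-1` [set 1] by [].
apply: closed_comp; last exact: closed_eq.
by move=> x _; apply: (@cvg_dot _ _ (nbhs x)).
Qed.

(** Connectedness of [0, 1]: otherwise the indicator function of [g t == g 0] would be continuous
    and, by the intermediate value theorem, take the value 1/2. *)
Lemma locally_cst_path (R : realType) (T : choiceType) (g : R -> T) :
  (forall t, 0 <= t <= 1 -> exists2 r, 0 < r & forall t', `|t - t'| < r -> g t' = g t) ->
  g 0 = g 1.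
Proof.
move=> gl; apply/eqP; case: (boolP (g 0 == g 1)) => // g01.
pose h t : R := if g t == g 0 then 1 else 0.
have ch : {within `[0, 1], continuous h}.
  apply: continuous_in_subspaceT => t; rewrite inE /= in_itv /= => /gl[r r0 rP].
  apply/cvgrPdist_lt => e e0; apply: (nbhs_ballP t _).2; exists r; first exact: r0.
  by move=> t' /rP E; rewrite /h /= E subrr normr0.
have h0 : h 0 = 1 by rewrite /h eqxx.
have h1 : h 1 = 0 by rewrite /h eq_sym (negbTE g01).
have hv : Num.min (h 0) (h 1) <= 2^-1 <= Num.max (h 0) (h 1).
  rewrite h0 h1 ge_min le_max; apply/andP; split; apply/orP; [right|left]; lra.
have [t _] := IVT ler01 ch hv; rewrite /h; case: eqP => _; lra.
Qed.

(* A point z with G z <> - north is moved by lifting through G, step by step, the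
   contraction rho^k p of the stereographic coordinate p of G z; it ends in the
   fibre over north. The endpoint flow z is locally constant in z and fixes the
   fibre. The complement of the finite fibre over - north is connected, so the
   fibre over north is a singleton. *)
Section Covering.
Variable R : realType.
Local Notation S2 := (sphere R 2).
Local Notation dist a b := (`|set_val (a : S2) - set_val (b : S2)|).
Variable G : S2 -> 'rV[R]_3.
Hypothesis Gunit : forall z, dot (G z) (G z) = 1.
Hypothesis Gcont : forall z (e : R), 0 < e -> exists2 d, 0 < d &
  forall z', dist z z' < d -> `|G z - G z'| < e.
Hypothesis Ginj : forall z, exists2 e, 0 < e &
  forall a b, dist z a < e -> dist z b < e -> G a = G b -> a = b.
Hypothesis Gopen : forall z (e : R), 0 < e -> exists2 d, 0 < d &
  forall y, dot y y = 1 -> `|G z - y| < d -> exists2 z', dist z z' < e & G z' = y.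

Let triangle (x y z : 'rV[R]_3) (a b : R) : `|x - y| < a -> `|y - z| < b -> `|x - z| < a + b.
Proof. by move=> xy yz; apply: le_lt_trans (ler_distD y _ _) (ltrD xy yz). Qed.

Let distC (a b : S2) : dist a b = dist b a. Proof. exact: distrC. Qed.

(** Compactness of the sphere turns radii that depend on the point into a single one. The hypothesis
    covers all small [d], as required by the filter of positive reals near 0. *)
Let uniform (P : R -> S2 -> Prop) :
  (forall z, exists2 e, 0 < e & forall d z', 0 < d < e -> dist z z' < e -> P d z') ->
  exists2 d, 0 < d & forall z, P d z.
Proof.
move=> loc.
have [d [d0 dP]] : exists d : R, 0 < d /\
    (sphere R 2 : set 'rV[R]_3) `<=` fun x => forall z : S2, set_val z = x -> P d z.
  have /compact_near_coveringP cov := @sphere_compact R 2.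
  have h : \forall d \near 0^'+, (sphere R 2 : set 'rV[R]_3) `<=`
      fun x => forall z : S2, set_val z = x -> P d z.
    apply: cov => x Sx; pose z0 : S2 := exist _ x (mem_set Sx).
    have [e e0 eP] := loc z0.
    exists (ball x e, [set d | 0 < d < e]) => /=.
      split; first exact: nbhsx_ballx.
      near=> d; apply/andP; split; near: d; [exact: nbhs_right_gt|exact: nbhs_right_lt].
    move=> [x' d] /= [xx' de] z zx'; apply: eP => //.
    by move: xx'; rewrite -ball_normE /= -zx'.
  by have [d [d0 hd]] := filter_ex (filterI (nbhs_right_gt (0 : R)) h); exists d.
exists d => // z; exact: (dP _ (set_mem (valP z)) z).
Unshelve. all: by end_near. Qed.

Lemma covering_separated : exists2 d, 0 < d & forall a b, dist a b < d -> G a = G b -> a = b.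
Proof.
have [|d d0 dP] := uniform (P := fun d z => forall b, dist z b < d -> G z = G b -> z = b).
  move=> z; have [e e0 eP] := Ginj z; exists (e / 2); first by rewrite divr_gt0.
  move=> d a /andP[d0 de] za b ab; apply: eP; last first.
    by apply: lt_trans (triangle za ab) _; lra.
  by apply: lt_le_trans za _; lra.
by exists d => // a b; exact: dP.
Qed.

Lemma covering_lift (e : R) : 0 < e -> exists2 d, 0 < d &
  forall z y, dot y y = 1 -> `|G z - y| < d -> exists2 z', dist z z' < e & G z' = y.
Proof.
move=> e0; have [|d d0 dP] := uniform (P := fun d z => forall y, dot y y = 1 ->
   `|G z - y| < d -> exists2 z', dist z z' < e & G z' = y); last by exists d.
move=> z; have e2 : 0 < e / 2 by rewrite divr_gt0.
have [d d0 dP] := Gopen z e2.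
have d2 : 0 < d / 2 by rewrite divr_gt0.
have [c c0 cP] := Gcont z d2.
exists (Num.min (Num.min (e / 2) c) (d / 2)); first by rewrite !lt_min e2 c0 d2.
move=> r a; rewrite !lt_min => /andP[r0 /andP[/andP[re rc] rd]] /andP[/andP[ae ac] ad] y yy Gay.
have [||z' zz' Gz'] := dP y; first exact: yy.
  apply: lt_trans (triangle (cP a ac) Gay) _.
  by lra.
exists z' => //; rewrite [ltRHS]splitr; apply: triangle zz'.
by rewrite distrC.
Qed.

Let delta := s2val (cid2 covering_separated).
Let delta0 : 0 < delta. Proof. by rewrite /delta; case: cid2. Qed.
Let deltaP a b : dist a b < delta -> G a = G b -> a = b.
Proof. by rewrite /delta; case: cid2 => /= d _; exact. Qed.

(** A quarter, because two points of a fibre are compared through chains of at most four moves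
    shorter than [eta]. *)
Let eta := delta / 4.
Let eta0 : 0 < eta. Proof. by rewrite divr_gt0. Qed.

Let eps := s2val (cid2 (covering_lift eta0)).
Let eps0 : 0 < eps. Proof. by rewrite /eps; case: cid2. Qed.
Let epsP z y : dot y y = 1 -> `|G z - y| < eps -> exists2 z', dist z z' < eta & G z' = y.
Proof. by rewrite /eps; case: cid2 => /= d _; exact. Qed.

Let near_eq a b : dist a b < eta + eta + (eta + eta) -> G a = G b -> a = b.
Proof.
move=> ab; apply: deltaP; apply: lt_le_trans ab _.
by rewrite /eta le_eqVlt; apply/orP; left; apply/eqP; field.
Qed.

Let lift (z : S2) (y : 'rV[R]_3) : S2 :=
  xget z [set z' | dist z z' < eta /\ G z' = y].

Let liftP z y : dot y y = 1 -> `|G z - y| < eps -> dist z (lift z y) < eta /\ G (lift z y) = y.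
Proof.
move=> yy zy; have [z' zz' Gz'] := epsP yy zy.
have : [set z' | dist z z' < eta /\ G z' = y] z' by split.
exact: xgetI.
Qed.

(** Lifting [y1] from [lift z y] gives a point [q] over [y1], four moves away from [lift z1 y1],
    which lies over [y1] too; hence they coincide. *)
Let lift_close z z1 y y1 : dot y y = 1 -> dot y1 y1 = 1 ->
  `|G z - y| < eps -> `|G z1 - y1| < eps -> `|y - y1| < eps -> dist z z1 < eta ->
  dist (lift z y) (lift z1 y1) < eta.
Proof.
move=> yy yy1 zy zy1 y01 zz1; have [l1 l2] := liftP yy zy; have [m1 m2] := liftP yy1 zy1.
have [|q lq Gq] := @epsP (lift z y) y1 yy1; first by rewrite l2.
suff <- : q = lift z1 y1 by [].
apply: near_eq; last by rewrite Gq m2.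
apply: (triangle (y := set_val z)); last exact: triangle zz1 m1.
by rewrite distrC; apply: triangle l1 lq.
Qed.

(** One contraction step moves a point of the sphere by at most 2 (1 - rho), which this choice keeps
    below [eps]; the minimum with 1 keeps [rho] positive. *)
Let rho := 1 - Num.min 1 (eps / 2) / 2.

Let rhoP : 0 < rho < 1 /\ 2 * (1 - rho) < eps.
Proof.
have m0 : 0 < Num.min 1 (eps / 2) by rewrite lt_min ltr01 divr_gt0.
have m1 : Num.min 1 (eps / 2) <= 1 by rewrite ge_min lexx.
have m2 : Num.min 1 (eps / 2) <= eps / 2 by rewrite ge_min lexx orbT.
by rewrite /rho; split; [apply/andP; split|]; move: eps0 m0 m1 m2; set m := Num.min _ _; lra.
Qed.

Let good z := 1 + pole_sign R false * (G z) 0 2%:R != 0.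

Let track (z : S2) k : 'rV[R]_3 := stereo_pt false (rho ^+ k *: unstereo false (G z)).

Let track_unit z k : dot (track z k) (track z k) = 1.
Proof. exact: (set_mem (stereo_subproof _ _)). Qed.

Let track_step z k : `|track z k - track z k.+1| < eps.
Proof.
have [/andP[r0 r1] rE] := rhoP.
apply: norm_lt_dot => //; rewrite stereo_dist.
set p := rho ^+ k *: _; have -> : rho ^+ k.+1 *: unstereo false (G z) = rho *: p.
  by rewrite /p scalerA exprS.
clearbody p.
have -> : p - rho *: p = (1 - rho) *: p by rewrite (scalerBl 1 rho) scale1r.
rewrite !dotZl !dotZr; have := dot_ge0 p; set s := dot p p => s0.
have q : 0 <= rho * (rho * s) by rewrite mulr_ge0 ?mulr_ge0 ?(ltW r0).
have q1 : 0 < (1 + s) * (1 + rho * (rho * s)) by rewrite mulr_gt0 ?ltr_pwDl.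
rewrite ltr_pdivrMr//.
have h : (2 * (1 - rho)) ^+ 2 < eps ^+ 2.
  by rewrite ltr_pXn2r// nnegrE ?(ltW eps0)// mulr_ge0// subr_ge0 ltW.
apply: (@le_lt_trans _ _ ((2 * (1 - rho)) ^+ 2 * ((1 + s) * (1 + rho * (rho * s))))).
  have -> : 4 * ((1 - rho) * ((1 - rho) * s)) = (2 * (1 - rho)) ^+ 2 * s by ring.
  rewrite ler_wpM2l ?sqr_ge0//.
  have q2 : 0 <= s * (rho * (rho * s)) by rewrite mulr_ge0.
  by move: q q2; set t := rho * (rho * s) => t0 st0; lra.
by rewrite ltr_pM2r.
Qed.

Let track_north z (e : R) : 0 < e -> exists K, forall k, (K <= k)%N -> `|track z k - north R| < e.
Proof.
move=> e0; have [/andP[r0 r1] _] := rhoP.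
have : forall p, p = unstereo false (G z) -> exists K, forall k, (K <= k)%N ->
  `|stereo_pt false (rho ^+ k *: p) - north R| < e; last by move=> /(_ _ erefl).
move=> p _; have : rho ^+ k @[k --> \oo] --> 0 by apply: cvg_expr; rewrite gtr0_norm.
pose c := e / (2 * (1 + `|Num.sqrt (dot p p)|)).
have c0 : 0 < c by rewrite divr_gt0// mulr_gt0// ltr_pwDl.
move=> /cvgrPdist_lt /(_ c c0)[K _ KP]; exists K => k /KP; rewrite /= sub0r normrN => rk.
have rk0 : 0 <= rho ^+ k by rewrite exprn_ge0// ltW.
rewrite ger0_norm// in rk.
apply: norm_lt_dot => //; rewrite /north stereo_dist subr0 dot0l addr0 mulr1 dotZl dotZr -/p.
set s := dot p p; have s0 : 0 <= s by exact: dot_ge0.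
apply: (@le_lt_trans _ _ ((2 * (rho ^+ k * Num.sqrt s)) ^+ 2)).
  rewrite ler_pdivrMr ?ltr_pwDl// ?mulr_ge0//.
  have -> : 4 * (rho ^+ k * (rho ^+ k * s)) = (2 * (rho ^+ k * Num.sqrt s)) ^+ 2 * 1.
    by rewrite mulr1 !exprMn sqr_sqrtr//; ring.
  by rewrite ler_wpM2l ?sqr_ge0// lerDl !mulr_ge0.
rewrite ltr_pXn2r// ?nnegrE ?(ltW e0) ?mulr_ge0 ?sqrtr_ge0//.
have rs : rho ^+ k * (2 * (1 + Num.sqrt s)) < e.
  rewrite -ltr_pdivlMr ?mulr_gt0 ?ltr_pwDl ?sqrtr_ge0//.
  by move: rk; rewrite /c -/s ger0_norm ?sqrtr_ge0.
apply: le_lt_trans rs; rewrite [leRHS]mulrCA ler_pM2l//.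
by rewrite ler_wpM2l// lerDr.
Qed.

Let w (z : S2) : nat -> S2 := fix w k := if k is k'.+1 then lift (w k') (track z k) else z.

Let track0 z : good z -> track z 0 = G z.
Proof. by move=> gz; rewrite /track expr0 scale1r unstereoK. Qed.

Let wP z k : good z -> G (w z k) = track z k /\ dist (w z k) (w z k.+1) < eta.
Proof.
move=> gz; suff Gw : G (w z k) = track z k.
  by split=> //; apply: (liftP (track_unit z k.+1) _).1; rewrite Gw track_step.
elim: k => [|k IH]; first by rewrite track0.
by apply: (liftP (track_unit z k.+1) _).2; rewrite IH track_step.
Qed.

(** Convergence of [w z] is replaced by staying within [eta] of a point over [north], which by
    [near_eq] already determines that point. *)
Let limit z q := G q = north R /\ exists K, forall k, (K <= k)%N -> dist (w z k) q < eta.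

Let north_unit : dot (north R) (north R) = 1.
Proof. exact: (set_mem (stereo_subproof _ _)). Qed.

(** Once the track is within [eps] of [north], each [w z k] has a point over [north] within [eta].
    Consecutive such points are less than 3 [eta] apart, so they are all the same. *)
Let limit_ex z : good z -> exists q, limit z q.
Proof.
move=> gz; have [K KP] := track_north z eps0.
have cl k : (K <= k)%N -> exists2 q, dist (w z k) q < eta & G q = north R.
  by move=> /KP h; apply: epsP => //; rewrite (wP k gz).1.
have [q Kq Gq] := cl K (leqnn K); exists q; split => //; exists K => k.
move=> /subnK <-; elim: (k - K)%N => [|j IH]; first by rewrite add0n.
have [q' jq' Gq'] := cl (j.+1 + K)%N (leq_addl _ _).
suff -> : q = q' by [].
apply: near_eq; last by rewrite Gq Gq'.
have h := triangle (wP (j + K)%N gz).2 jq'.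
rewrite distC in IH; have := triangle IH h; rewrite -/(w z _) => /lt_trans; apply.
by have := eta0; lra.
Qed.

Let limit_close z z' q q' : limit z q -> limit z' q' ->
  (forall k, dist (w z k) (w z' k) < eta) -> q = q'.
Proof.
move=> [Gq [K KP]] [Gq' [K' KP']] h; apply: near_eq; last by rewrite Gq Gq'.
have h1 := KP _ (leq_maxl K K'); have h2 := KP' _ (leq_maxr K K').
rewrite distC in h1; have := triangle h1 (triangle (h _) h2) => /lt_trans; apply.
by have := eta0; lra.
Qed.

Let flow z : S2 := xget z (limit z).

Let flowP z : good z -> limit z (flow z).
Proof. by move=> /limit_ex; exact: xgetPex. Qed.

Let good_fiber z : G z = north R -> good z.
Proof.
by move=> Gz; rewrite /good Gz stereo_pole mulf_neq0 ?invr_eq0 ?onep_dot_neq0// pnatr_eq0.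
Qed.

Let flow_fiber z : G z = north R -> flow z = z.
Proof.
move=> Gz; have gz := good_fiber Gz.
have tz k : track z k = north R.
  by rewrite /track Gz stereoK scaler0.
have wz k : w z k = z.
  elim: k => //= k IH; rewrite tz.
  have [|zl Gl] := @liftP (w z k) _ north_unit; first by rewrite IH Gz subrr normr0.
  apply/esym; apply: near_eq; last by rewrite Gz Gl.
  apply: lt_trans (_ : eta < _); first by move: zl; rewrite IH.
  by have := eta0; lra.
have [Gf [K KP]] := flowP gz; apply/esym; apply: near_eq; last by rewrite Gz Gf.
have := KP K (leqnn K); rewrite wz => /lt_trans; apply.
by have := eta0; lra.
Qed.

(** Contraction in the chart does not increase distances there, so starting close enough keeps the
    two tracks within [eps] for all [k] at once. By [lift_close] the lifts stay within [eta], and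
    their endpoints agree. *)
Let flow_locally_cst z0 : good z0 -> exists2 d, 0 < d &
  forall z, dist z0 z < d -> flow z = flow z0.
Proof.
move=> g0; set y0 := G z0; set p0 := unstereo false y0.
pose pole (y : 'rV[R]_3) := 1 + pole_sign R false * y 0 2%:R.
have h1 : \forall y \near y0, pole y != 0.
  have h : pole y @[y --> y0] --> pole y0.
    apply: differentiable_continuous; apply: differentiableD => //.
    by apply: differentiableM => //; exact: differentiable_coord.
  exact: cvgr_neq0 h g0.
have h2 : \forall y \near y0,
    dot (p0 - unstereo false y) (p0 - unstereo false y) < (eps / 2) ^+ 2.
  have h : dot (p0 - unstereo false y) (p0 - unstereo false y) @[y --> y0] --> (0 : R).
    have c : p0 - unstereo false y @[y --> y0] --> (0 : 'rV[R]_2).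
      have c' : unstereo false y @[y --> y0] --> p0.
        by apply: differentiable_continuous; exact: differentiable_unstereo.
      by rewrite -(subrr p0); exact: (cvgB (cvg_cst p0) c').
    by have := cvg_dot c c; rewrite dot0l; apply.
  by apply: (cvgr_lt _ h); rewrite exprn_gt0 ?divr_gt0 ?eps0.
have [r /= r0 rP] := (nbhs_ballP (y0 : 'rV[R]_3) _).1 (filterI h1 h2).
have [d d0 dP] := Gcont z0 r0.
exists (Num.min d eta); first by rewrite lt_min d0.
move=> z; rewrite lt_min => /andP[zd ze].
have [|gz pz] := rP (G z); first by rewrite -ball_normE /=; exact: dP.
have tc k : `|track z0 k - track z k| < eps.
  apply: norm_lt_dot => //; rewrite stereo_dist -scalerBr dotZl dotZr -/p0.
  have [/andP[rr0 rr1] _] := rhoP.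
  have rk0 : 0 <= rho ^+ k by rewrite exprn_ge0// ltW.
  have rk1 : rho ^+ k <= 1 by rewrite exprn_ile1// ltW.
  move: pz; rewrite -/p0; set q := unstereo false (G z); set D := dot (p0 - q) _ => pz.
  have D0 : 0 <= D by exact: dot_ge0.
  have m1 (p : 'rV[R]_2) : 1 <= 1 + dot p p by rewrite lerDl dot_ge0.
  rewrite ltr_pdivrMr; last by rewrite mulr_gt0// onep_dot_gt0.
  apply: (@lt_le_trans _ _ (eps ^+ 2)); last first.
    rewrite ler_peMr ?sqr_ge0//; apply: le_trans (m1 (rho ^+ k *: p0)) _.
    by rewrite ler_peMr// (le_trans ler01).
  apply: le_lt_trans (_ : 4 * D < _).
    rewrite ler_pM2l//; apply: le_trans (_ : rho ^+ k * D <= _).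
      by rewrite ler_wpM2l// ler_piMl.
    by rewrite ler_piMl.
  by move: pz; rewrite expr_div_n ltr_pdivlMr// mulrC -natrX.
apply/esym; apply: (limit_close (flowP g0) (flowP gz)).
elim=> [|k IH] //=; apply: lift_close => //.
  by rewrite (wP k g0).1 track_step.
by rewrite (wP k gz).1 track_step.
Qed.

Let flow_path (c : R -> S2) :
  (forall t e, 0 < e -> exists2 d, 0 < d & forall t', `|t - t'| < d -> dist (c t) (c t') < e) ->
  (forall t, 0 <= t <= 1 -> good (c t)) -> flow (c 0) = flow (c 1).
Proof.
move=> cc cg; apply: (@locally_cst_path R S2 (fun t => flow (c t))) => t t01.
have [d d0 dP] := flow_locally_cst (cg t t01).
have [r r0 rP] := cc t d d0.
by exists r; [exact: r0|move=> t' tt'; exact: (dP (c t') (rP t' tt'))].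
Qed.

Let flow_segment b u v :
  (forall t, 0 <= t <= 1 -> good (stereo b (u + t *: v))) ->
  flow (stereo b u) = flow (stereo b (u + v)).
Proof.
move=> gs; have := flow_path (c := fun t => stereo b (u + t *: v)).
rewrite scale0r addr0 scale1r; apply => // t e e0.
set s := dot v v; have s0 : 0 <= s by exact: dot_ge0.
have s1 : 0 < 1 + s by rewrite ltr_pwDl.
(* The chord is at most 2 |t - t'| sqrt s, and sqrt s < 1 + s. *)
exists (e / (2 * (1 + s))); first by rewrite divr_gt0 ?mulr_gt0.
move=> t' tt'; apply: norm_lt_dot => //; rewrite stereo_dist.
have -> : u + t *: v - (u + t' *: v) = (t - t') *: v.
  by rewrite scalerBl opprD addrACA subrr add0r.
rewrite dotZl dotZr -/s.
have m1 (p : 'rV[R]_2) : 1 <= 1 + dot p p by rewrite lerDl dot_ge0.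
rewrite ltr_pdivrMr; last by rewrite mulr_gt0// onep_dot_gt0.
apply: (@lt_le_trans _ _ (e ^+ 2)); last first.
  rewrite ler_peMr ?sqr_ge0//; apply: le_trans (m1 (u + t *: v)) _.
  by rewrite ler_peMr// (le_trans ler01).
have D : (t - t') ^+ 2 < (e / (2 * (1 + s))) ^+ 2.
  by rewrite -(real_normK (num_real (t - t'))) ltr_pXn2r// nnegrE ltW// divr_gt0 ?mulr_gt0.
have -> : 4 * ((t - t') * ((t - t') * s)) = 4 * s * (t - t') ^+ 2 by ring.
apply: le_lt_trans (_ : 4 * s * (e / (2 * (1 + s))) ^+ 2 < _).
  by rewrite ler_wpM2l ?mulr_ge0// ltW.
have -> : 4 * s * (e / (2 * (1 + s))) ^+ 2 = e ^+ 2 * (s / (1 + s) ^+ 2).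
  by field; rewrite gt_eqF.
rewrite gtr_pMr ?exprn_gt0// ltr_pdivrMr ?exprn_gt0// mul1r.
have q : 0 <= s * s by rewrite mulr_ge0.
by rewrite expr2; lra.
Qed.

Let bad := [set z : S2 | ~~ good z].

(** This is the fibre over - [north]. Its points are [delta]-separated, and finitely many balls of
    radius [delta / 2] cover the sphere, each containing at most one of them. *)
Let bad_finite : finite_set bad.
Proof.
have /= := @sphere_compact R 2; rewrite compact_cover => cov.
have d2 : 0 < delta / 2 by rewrite divr_gt0.
have [||D _ DS] := cov _ (sphere R 2 : set 'rV[R]_3) (fun x => ball x (delta / 2)).
- by move=> x _; exact: ball_open.
- by move=> x Sx; exists x => //; exact: ballxx.
have badS z z' : bad z -> bad z' -> G z = G z'.
  have E a : bad a -> G a = - north R.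
    rewrite /bad /= negbK => /eqP Ga; have := Gunit a; rewrite dot3E.
    have a2 : G a 0 2%:R = -1.
      by apply/eqP; rewrite -addr_eq0 addrC; apply/eqP; rewrite -Ga /pole_sign expr0 mul1r.
    rewrite a2 mulrNN mulr1 => /eqP; rewrite -subr_eq0 addrK paddr_eq0 -?expr2 ?sqr_ge0//.
    rewrite !sqrf_eq0 => /andP[/eqP a0 /eqP a1].
    by apply: row3P; rewrite ?a0 ?a1 ?a2 !mxE /= ?mxE dot2E !mxE; field.
  by move=> /E -> /E ->.
have bf (x : 'rV[R]_3) : finite_set (bad `&` [set z | ball x (delta / 2) (set_val z)]).
  have [[z0 [bz0 xz0]]|h] := pselect (bad `&` [set z | ball x (delta / 2) (set_val z)] !=set0).
    apply: (@sub_finite_set _ _ [set z0]); last exact: finite_set1.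
    move=> z [bz xz] /=; apply: deltaP; last exact: badS.
    move: xz xz0; rewrite -!ball_normE /= => xz xz0; rewrite [ltRHS]splitr.
    by apply: triangle xz0; rewrite distrC.
  by rewrite (_ : _ `&` _ = set0)//; apply/seteqP; split => // z hz; case: h; exists z.
have sub : bad `<=` \bigcup_(x in [set` D]) (bad `&` [set z | ball x (delta / 2) (set_val z)]).
  move=> z bz; have [x Dx xz] := DS _ (set_mem (valP z)).
  by exists x.
apply: (sub_finite_set sub); apply: bigcup_finite => [|x _]; [exact: finite_fset|exact: bf].
Qed.

Let avoid (f : S2 -> R) (g : S2 -> R) : exists s, forall z, bad z -> s != f z /\ s != g z.
Proof.
have [s sP] : exists s, ~ (f @` bad `|` g @` bad) s.
  by apply: finite_set_notin; rewrite finite_setU; split; exact: finite_image.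
by exists s => z bz; split; apply/eqP => E; apply: sP; [left|right]; exists z.
Qed.

(* Go from u to v through an apex on the perpendicular bisector. A point of the
   finite set bad lies on such a path for at most two positions s of the apex. *)
Let flow_chart b u v : good (stereo b u) -> good (stereo b v) ->
  flow (stereo b u) = flow (stereo b v).
Proof.
move=> gu gv; have [->//|uv] := eqVneq u v.
pose d := v - u; have d0 : dot d d != 0 by rewrite dot_eq0 subr_eq0 eq_sym.
pose J : 'rV[R]_2 := \row_j [:: - d 0 1; d 0 0]`_j.
have Jd : dot J d = 0 by rewrite dot2E !mxE /=; ring.
have JJ : dot J J = dot d d by rewrite !dot2E !mxE /=; ring.
pose pt (z : S2) := unstereo b (set_val z).
have [s sP] := avoid
  (fun z => 2^-1 * (dot (pt z - u) J / dot (pt z - u) d))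
  (fun z => - 2^-1 * (dot (pt z - v) J / dot (pt z - v) d)).
(* On the ray from [x] in direction k d + s J, the J-component over the d-component is s / k, so a
   bad point determines [s]. The rays with k = 1/2 from [u] and k = -1/2 from [v] meet at the
   apex. *)
have seg x (k : R) : k != 0 -> good (stereo b x) ->
    (forall z, bad z -> s != k * (dot (pt z - x) J / dot (pt z - x) d)) ->
    forall t, 0 <= t <= 1 -> good (stereo b (x + t *: (k *: d + s *: J))).
  move=> k0 gx sx t _; apply: contraT => gb; have /negP[] := sx _ gb.
  rewrite /pt /= stereoK addrAC subrr add0r !dotZl !dotDl !dotZl Jd JJ (dotC d) Jd.
  rewrite !mulr0 add0r addr0.
  have t0 : t != 0 by apply: contraNneq gb => ->; rewrite scale0r addr0.
  by apply/eqP; field; rewrite t0 k0 d0.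
have k2 : (2^-1 : R) != 0 by rewrite invr_eq0 pnatr_eq0.
rewrite (flow_segment (seg u 2^-1 k2 gu (fun z bz => (sP z bz).1))).
have k2' : - 2^-1 != 0 :> R by rewrite oppr_eq0.
rewrite (flow_segment (seg v (- 2^-1) k2' gv (fun z bz => (sP z bz).2))).
by congr (flow (stereo b _)); apply: row2P; rewrite !mxE; field.
Qed.

(** Found on the first coordinate axis. With A = {0} the point avoids both poles, hence belongs to
    both charts and can serve as a common base point. *)
Let good_chart (A : set R) : finite_set A -> exists u : 'rV[R]_2,
  good (stereo false u) /\ ~ A (u 0 0).
Proof.
move=> fA.
have [s sP] : exists s, ~ (A `|` (fun z : S2 => unstereo false (set_val z) 0 0) @` bad) s.
  by apply: finite_set_notin; rewrite finite_setU; split => //; exact: finite_image.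
exists (s *: delta_mx 0 0); split; last first.
  by rewrite !mxE mulr1 => As; apply: sP; left.
apply: contraT => gs; exfalso; apply: sP; right.
by exists (stereo false (s *: delta_mx 0 0)) => //=; rewrite stereoK !mxE mulr1.
Qed.

Let flow_cst a z : good a -> good z -> flow a = flow z.
Proof.
have chart (x : S2) b : 1 + pole_sign R b * (set_val x) 0 2%:R != 0 ->
    exists u, x = stereo b u.
  move=> h; exists (unstereo b (set_val x)); apply: val_inj.
  by rewrite /= unstereoK// sphere_unit.
have same b (x x' : S2) : good x -> good x' -> 1 + pole_sign R b * (set_val x) 0 2%:R != 0 ->
    1 + pole_sign R b * (set_val x') 0 2%:R != 0 -> flow x = flow x'.
  by move=> gx gx' /chart[u E] /chart[u' E']; rewrite E E' in gx gx' *; exact: flow_chart.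
have [u [gu u0]] := good_chart (finite_set1 (0 : R)).
have any (x : S2) : good x -> flow x = flow (stereo false u).
  move=> gx.
  have uc b : 1 + pole_sign R b * (stereo_pt false u) 0 2%:R != 0.
    case: b; last exact: stereo_pole_neq0.
    rewrite mxE /= /pole_sign expr1 expr0 mul1r; have c0 := onep_dot_neq0 u.
    have -> : 1 + -1 * ((1 - dot u u) / (1 + dot u u)) = 2 * dot u u / (1 + dot u u).
      by field.
    rewrite !mulf_neq0 ?invr_eq0 ?pnatr_eq0// dot_eq0.
    by apply/eqP => E; apply: u0; rewrite E mxE.
  have [x2|x2] := eqVneq (1 + pole_sign R false * (set_val x) 0 2%:R) 0.
    apply: (same true) => //; move: x2; rewrite /pole_sign expr0 expr1 mul1r mulN1r => /eqP.
    by rewrite addrC addr_eq0 => /eqP ->; rewrite opprK -[1 + 1]/(2%:R) pnatr_eq0.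
  by apply: (same false).
by move=> ga gz; rewrite (any a ga) (any z gz).
Qed.

Lemma covering_north : exists2 z, G z = north R & forall z', G z' = north R -> z' = z.
Proof.
have [u [gu _]] := good_chart (@finite_set0 R).
have [Gz _] := flowP gu; exists (flow (stereo false u)) => // z' Gz'.
by rewrite -[LHS](flow_fiber Gz'); apply: flow_cst => //; exact: good_fiber.
Qed.

End Covering.

(** * The Gauss map of a surface *)

Section ChainRule.
Variable R : realType.

Lemma pd_comp (W : normedModType R) (g : 'rV[R]_2 -> W) (tau : 'rV[R]_2 -> 'rV[R]_2) i u :
  differentiable tau u -> differentiable g (tau u) ->
  pd i (g \o tau) u = pd i tau u 0 0 *: pd 0 g (tau u) + pd i tau u 0 1 *: pd 1 g (tau u).
Proof.
move=> dtau dg; have dc := differentiable_comp dtau dg.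
rewrite !unlock /partial (deriveE _ dc) !(deriveE _ dg) (deriveE _ dtau).
have C : 'd (g \o tau) u (delta_mx 0 i) = 'd g (tau u) ('d tau u (delta_mx 0 i)) :=
  congr1 (fun h : 'rV[R]_2 -> W => h (delta_mx 0 i)) (diff_comp dtau dg).
apply: etrans C _.
move: ('d tau u (delta_mx 0 i)) => v.
by rewrite {1}(row_sum_delta v) linear_sum sum2E !linearZ.
Qed.

Lemma pd_near (W : normedModType R) (g h : 'rV[R]_2 -> W) i u :
  (\forall v \near u, g v = h v) -> pd i g u = pd i h u.
Proof.
move=> gh; rewrite !unlock; apply: near_eq_derive; last exact: gh.
Qed.

Lemma frame_det3 (v0 v1 v2 : 'rV[R]_3) :
  frame_det [tuple v0; v1; v2] = dot v0 (cross3 v1 v2).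
Proof.
pose F i j : R := (nth 0 [:: v0; v1; v2] i) 0 (inord j).
have <- : \det (nat_mx 3 F) = frame_det [tuple v0; v1; v2].
  congr (\det _); apply/matrixP => i j; rewrite !mxE /F inord_val.
  by rewrite (tnth_nth 0).
have i0 : inord 0 = 0 :> 'I_3 by apply: val_inj; rewrite /= inordK.
have i1 : inord 1 = 1 :> 'I_3 by apply: val_inj; rewrite /= inordK.
have i2 : inord 2 = 2%:R :> 'I_3 by apply: val_inj; rewrite /= inordK.
by rewrite det3_nat /F /= i0 i1 i2 dot3E !mxE /=; ring.
Qed.

Lemma stereo_oriented b (u : 'rV[R]_2) :
  0 < dot (stereo_pt b u) (cross3 (partial 0 (stereo_pt b) u) (partial 1 (stereo_pt b) u)).
Proof.
have h := onep_dot_neq0 u.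
have -> : dot (stereo_pt b u) (cross3 (partial 0 (stereo_pt b) u) (partial 1 (stereo_pt b) u)) =
    4 * (1 + dot u u) ^- 2.
  rewrite dot3E !mxE /= !partial_stereo !mxE /=; move: h; rewrite dot2E => h.
  by case: b; rewrite ?expr0 ?expr1; field.
by rewrite mulr_gt0// invr_gt0 exprn_gt0// onep_dot_gt0.
Qed.

End ChainRule.

(** * Independence of charts and parametrizations *)

Section SurfaceChart.
Variable R : realType.
Local Notation S2 := (sphere R 2).
Local Notation S3 := (sphere R 3).

Lemma in_chart_unit n (x : S2 -> sphere R n) b u : dot (in_chart x b u) (in_chart x b u) = 1.
Proof. exact: sphere_unit. Qed.

Lemma immersion_det (x : S2 -> S3) b u :
  immersion x -> \det (metric (in_chart x b) u) != 0.
Proof.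
move=> [sx ix]; apply/negP => /det0P[v v0 vg].
have df : differentiable (in_chart x b) u by exact: smooth_diff (sx b).
have dv : 'd (in_chart x b) u v = v 0 0 *: partial 0 (in_chart x b) u
    + v 0 1 *: partial 1 (in_chart x b) u.
  by rewrite /partial !deriveE// {1}(row_sum_delta v) linear_sum sum2E !linearZ.
have vgj j : v 0 0 * dot (partial 0 (in_chart x b) u) (partial j (in_chart x b) u)
    + v 0 1 * dot (partial 1 (in_chart x b) u) (partial j (in_chart x b) u) = 0.
  by have /rowP /(_ j) := vg; rewrite mxE sum2E !mxE.
have : dot ('d (in_chart x b) u v) ('d (in_chart x b) u v) = 0.
  rewrite dv; move: (vgj 0) (vgj 1) => {dv vgj vg ix}.
  move: (partial 0 (in_chart x b) u) (partial 1 (in_chart x b) u) => p q E0 E1.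
  transitivity (v 0 0 * (v 0 0 * dot p p + v 0 1 * dot q p)
    + v 0 1 * (v 0 0 * dot p q + v 0 1 * dot q q)); last by rewrite E0 E1 !mulr0 addr0.
  by rewrite dotDl !dotZl !dotDr !dotZr; ring.
move=> /eqP; rewrite dot_eq0 => /eqP dv0; move/eqP: v0; apply.
by apply: (ix b u); rewrite dv0 linear0.
Qed.

Lemma left_gauss_scale (f g : 'rV[R]_2 -> 'rV[R]_4) u v k : 0 < k ->
  left_normal f u = k *: left_normal g v -> left_gauss f u = left_gauss g v.
Proof.
move=> k0 E; rewrite /left_gauss E dotZl dotZr mulrA -expr2 sqrtrM ?sqr_ge0//.
rewrite sqrtr_sqr gtr0_norm// scalerA invfM mulrAC mulVf ?mul1r//.
by rewrite gt_eqF.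
Qed.

(** Near [u'] the new patch is the old one composed with [tau], so the chain rule multiplies
    [left_normal] by the Jacobian of [tau]. Comparing frame determinants on [S^2] shows that it is
    positive. The case phi = id is a change of chart. *)
Lemma left_gauss_reparam (x : S2 -> S3) (phi : S2 -> S2) b b' u u' :
  smooth_map x -> smooth_map phi ->
  0 < frame_det [tuple in_chart phi b' u'; partial 0 (in_chart phi b') u';
                 partial 1 (in_chart phi b') u'] ->
  phi (stereo b' u') = stereo b u ->
  left_gauss (in_chart (x \o phi) b') u' = left_gauss (in_chart x b) u.
Proof.
move=> sx sp; rewrite frame_det3 => pos phiu.
pose q := in_chart phi b'; pose tau v := unstereo b (q v).
have qu : q u' = stereo_pt b u by rewrite /q /in_chart phiu.
have dq : differentiable q u' by exact: smooth_diff (sp b').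
have pole0 : 1 + pole_sign R b * q u' 0 2%:R != 0 by rewrite qu stereo_pole_neq0.
have dtau : differentiable tau u'.
  by apply: (@differentiable_comp _ _ _ _ q (unstereo b)) => //; exact: differentiable_unstereo.
have tauu : tau u' = u by rewrite /tau qu stereoK.
have nearq : \forall v \near u', stereo_pt b (tau v) = q v.
  have dpole : differentiable (fun v => 1 + pole_sign R b * q v 0 2%:R) u'.
    apply: differentiableD => //; apply: differentiableM => //.
    exact: (differentiable_rowP q u').1.
  apply: filterS (cvgr_neq0 _ (differentiable_continuous dpole) pole0) => v qv.
  by rewrite /tau unstereoK//; exact: in_chart_unit.
have dst : differentiable (stereo_pt b) u by apply: rat_row_diff; exact: rat_row_stereo.
have df : differentiable (in_chart x b) u by exact: smooth_diff (sx b).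
have jq i : pd i q u' = pd i tau u' 0 0 *: pd 0 (stereo_pt b) u
    + pd i tau u' 0 1 *: pd 1 (stereo_pt b) u.
  have E : differentiable (stereo_pt b) (tau u') by rewrite tauu.
  have := pd_comp i dtau E; rewrite tauu => <-; apply: pd_near.
  by apply: filterS nearq => v /= ->.
have jf i : pd i (in_chart (x \o phi) b') u' = pd i tau u' 0 0 *: pd 0 (in_chart x b) u
    + pd i tau u' 0 1 *: pd 1 (in_chart x b) u.
  have E : differentiable (in_chart x b) (tau u') by rewrite tauu.
  have := pd_comp i dtau E; rewrite tauu => <-; apply: pd_near.
  apply: filterS nearq => v {}E; rewrite /in_chart /=; congr (set_val (x _)); apply: val_inj.
  by rewrite /= E.
have fu : in_chart (x \o phi) b' u' = in_chart x b u by rewrite /in_chart /= phiu.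
pose J := pd 0 tau u' 0 0 * pd 1 tau u' 0 1 - pd 0 tau u' 0 1 * pd 1 tau u' 0 0.
apply: (@left_gauss_scale _ _ _ _ J).
  have pE (h : 'rV[R]_2 -> 'rV[R]_3) i v : partial i h v = pd i h v by rewrite unlock.
  have := stereo_oriented b u; move: pos; rewrite -/q !pE qu !jq cross3_lin dotZr -/J.
  by move=> Js /pmulr_lgt0 <-.
have la i : left_form (in_chart (x \o phi) b') i u' =
    pd i tau u' 0 0 *: left_form (in_chart x b) 0 u
    + pd i tau u' 0 1 *: left_form (in_chart x b) 1 u.
  by rewrite /left_form fu jf mulmxDl -!scalemxAl.
rewrite /left_normal !la cross3_lin [X in _ = _ *: X]cross3C scalerN -scaleNr.
by congr (_ *: _); rewrite /J; ring.
Qed.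

Lemma left_gauss_chart (x : S2 -> S3) b b' u u' : smooth_map x -> stereo b' u' = stereo b u ->
  left_gauss (in_chart x b') u' = left_gauss (in_chart x b) u.
Proof.
move=> sx E; apply: (@left_gauss_reparam x id) => //.
  by move=> c; apply: rat_row_smooth; exact: rat_row_stereo.
by rewrite frame_det3; exact: stereo_oriented.
Qed.

End SurfaceChart.

Section Extremum.
Variable R : realType.

Lemma pd_local_max (h : 'rV[R]_2 -> R) i u (r : R) : (forall v, differentiable h v) -> 0 < r ->
  (forall v, `|u - v| < r -> h v <= h u) -> pd i h u = 0.
Proof.
move=> dh r0 hu; pose e : 'rV[R]_2 := delta_mx 0 i.
have D t := is_derive_line u e t dh.
have ee : dot e e = 1.
  by rewrite dot2E !mxE; move: (i); apply: ord2P; rewrite /=; ring.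
have max t : t \in `]-r, r[ -> h (u + t *: e) <= h (u + 0 *: e).
  rewrite in_itv /= => /andP[rt tr]; rewrite scale0r addr0; apply: hu.
  rewrite opprD addrA subrr add0r normrN; apply: norm_lt_dot => //.
  by rewrite dotZl dotZr ee mulr1 -expr2 -[t ^+ 2]real_normK ?num_real// ltr_pXn2r
    ?nnegrE ?(ltW r0)// ltr_norml rt.
have rr : - r <= r by rewrite ge0_cp// ltW.
have z : (0 : R) \in `]-r, r[ by rewrite in_itv /= oppr_lt0 r0.
have Z := derive1_at_max rr (fun t _ => @ex_derive _ _ _ _ _ _ _ (D t)) z max.
have := @derive_val _ _ _ _ _ _ _ Z; rewrite (@derive_val _ _ _ _ _ _ _ (D 0)).
by rewrite scale0r addr0 unlock.
Qed.

End Extremum.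

Lemma near_norm (R : realType) (V : normedModType R) (u : V) (P : set V) :
  nbhs u P -> exists2 d, 0 < d & forall v, `|u - v| < d -> P v.
Proof.
by move=> /nbhs_ballP[d /= d0 dP]; exists d => // v uv; apply: dP; rewrite -ball_normE.
Qed.

Lemma norm_dist_continuous (R : realType) (V : normedModType R) (u : V) :
  continuous (fun v => `|u - v|).
Proof.
move=> v; have c : w @[w --> v] --> v by exact: cvg_id.
exact: cvg_norm (cvgB (cvg_cst u) c).
Qed.

Lemma norm_ball_compact (R : realType) n (u : 'rV[R]_n.+1) (r : R) :
  compact [set v | `|u - v| <= r].
Proof.
apply: bounded_closed_compact.
  exists (`|u| + r); split; first exact: num_real.
  move=> M M1 v /= uv; apply: le_trans (ltW M1).
  rewrite -[v](subrK u) addrC; apply: le_trans (ler_normD _ _) _.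
  by rewrite lerD2l distrC.
have -> : [set v | `|u - v| <= r] = (fun v => `|u - v|) @^-1` [set t | t <= r] by [].
by apply: closed_comp; [move=> v _; exact: norm_dist_continuous|exact: closed_le].
Qed.

(** * The Gauss map on the whole sphere and its bijectivity *)

Section GaussMapOfSurface.
Variable R : realType.
Local Notation S2 := (sphere R 2).
Local Notation S3 := (sphere R 3).
Local Notation dist a b := (`|set_val (a : S2) - set_val (b : S2)|).

Lemma stereo_near b (u0 : 'rV[R]_2) (e : R) : 0 < e -> exists2 d, 0 < d &
  forall u, `|u0 - u| < d -> dist (stereo b u0) (stereo b u) < e.
Proof.
move=> e0; have c : {for u0, continuous (stereo_pt b)}.
  by apply: differentiable_continuous; apply: rat_row_diff; exact: rat_row_stereo.
have [d d0 dP] := near_norm ((cvgrPdist_lt _ _).1 c e e0).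
by exists d => // u uu; exact: dP.
Qed.

Lemma unstereo_near b (u0 : 'rV[R]_2) (e : R) : 0 < e -> exists2 d, 0 < d &
  forall z, dist (stereo b u0) z < d -> exists2 u, z = stereo b u & `|u0 - u| < e.
Proof.
move=> e0; set y0 : 'rV[R]_3 := stereo_pt b u0.
pose pole (y : 'rV[R]_3) := 1 + pole_sign R b * y 0 2%:R.
have p0 : pole y0 != 0 by exact: stereo_pole_neq0.
have cp : {for y0, continuous pole}.
  apply: differentiable_continuous; apply: differentiableD => //.
  by apply: differentiableM => //; exact: differentiable_coord.
have cu : {for y0, continuous (unstereo b)}.
  by apply: differentiable_continuous; exact: differentiable_unstereo.
have [d d0 dP] := near_norm
  (filterI (cvgr_neq0 _ cp p0) ((cvgrPdist_lt _ _).1 cu e e0)).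
exists d => // z /dP[pz uz]; exists (unstereo b (set_val z)).
  by apply: val_inj; rewrite /= unstereoK// sphere_unit.
by move: uz; rewrite /y0 stereoK.
Qed.

Variable x : S2 -> S3.
Hypothesis xcurved : x \in @curved_immersion_set R.

Let sx : smooth_map x. Proof. by have /set_mem[[]] := xcurved. Qed.
Let sxb b : smooth (in_chart x b). Proof. exact: sx. Qed.
Let f1 b u : dot (in_chart x b u) (in_chart x b u) = 1. Proof. exact: in_chart_unit. Qed.
Let detg b u : \det (metric (in_chart x b) u) != 0.
Proof. by apply: immersion_det; have /set_mem[] := xcurved. Qed.
Let Kpos b u : 0 < gauss_curvature (metric (in_chart x b)) u.
Proof. by have /set_mem[_] := xcurved; exact. Qed.

(** By [stereo_surj] and [left_gauss_chart] the set is a singleton for a curved immersion, so the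
    default 0 is not taken. *)
Definition surface_gauss (z : S2) : 'rV[R]_3 :=
  xget 0 [set n | exists b u, z = stereo b u /\ n = left_gauss (in_chart x b) u].

Lemma surface_gaussE b u : surface_gauss (stereo b u) = left_gauss (in_chart x b) u.
Proof.
apply: xget_unique; first by exists b, u.
by move=> _ [c [v [E ->]]]; exact: left_gauss_chart.
Qed.

Let dG b u : differentiable (left_gauss (in_chart x b)) u.
Proof. exact: differentiable_left_gauss. Qed.

Let surface_gauss_unit z : dot (surface_gauss z) (surface_gauss z) = 1.
Proof.
by have [b [u [-> _]]] := stereo_surj z; rewrite surface_gaussE left_gauss_unit.
Qed.

Let surface_gauss_cont z (e : R) : 0 < e -> exists2 d, 0 < d &
  forall z', dist z z' < d -> `|surface_gauss z - surface_gauss z'| < e.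
Proof.
have [b [u [-> _]]] := stereo_surj z => e0.
have c := differentiable_continuous (dG b u).
have [d d0 dP] := near_norm ((cvgrPdist_lt _ _).1 c e e0).
have [r r0 rP] := unstereo_near b u d0.
by exists r => // z' /rP[v -> uv]; rewrite !surface_gaussE; exact: dP.
Qed.

Let surface_gauss_inj z : exists2 e, 0 < e &
  forall a b, dist z a < e -> dist z b < e -> surface_gauss a = surface_gauss b -> a = b.
Proof.
have [b [u [-> _]]] := stereo_surj z.
have [e e0 eP] := left_gauss_locally_injective (sxb b) (f1 b) (detg b) (Kpos b) u.
rewrite -ball_normE in eP; have [r r0 rP] := unstereo_near b u e0.
exists r => // a a' /rP[v -> uv] /rP[v' -> uv']; rewrite !surface_gaussE => E.
by rewrite (eP v v' uv uv' E).
Qed.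

(* The point where <left_gauss, y> is maximal on a small ball around u is interior
   when y is close to left_gauss u, hence critical. *)
Let left_gauss_open b u (e : R) : 0 < e -> exists2 d, 0 < d &
  forall y, dot y y = 1 -> `|left_gauss (in_chart x b) u - y| < d ->
  exists2 v, `|u - v| < e & left_gauss (in_chart x b) v = y.
Proof.
move=> e0; set g := left_gauss (in_chart x b).
have gg v : dot (g v) (g v) = 1 by exact: left_gauss_unit.
have cg v : {for v, continuous g} by apply: differentiable_continuous; exact: dG.
have [e1 e10 inj] := left_gauss_locally_injective (sxb b) (f1 b) (detg b) (Kpos b) u.
pose r := Num.min e e1 / 2.
have m0 : 0 < Num.min e e1 by rewrite lt_min e0.
have r0 : 0 < r by rewrite divr_gt0.
have rm : r < Num.min e e1 by rewrite /r; lra.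
have [re re1] : r < e /\ r < e1 by move: rm; rewrite lt_min => /andP.
pose K := [set v : 'rV[R]_2 | `|u - v| <= r].
pose B := [set v : 'rV[R]_2 | `|u - v| = r].
have Kc : compact K by exact: norm_ball_compact.
have Bc : compact B.
  apply: (subclosed_compact _ Kc); last by move=> v; rewrite /K /B /= => ->.
  have -> : B = (fun v => `|u - v|) @^-1` [set r] by [].
  by apply: closed_comp; [move=> v _; exact: norm_dist_continuous|exact: closed_eq].
pose P (y : 'rV[R]_3) v := dot (g v) y < dot (g u) y.
(* On the compact boundary [g v] differs from [g u] by local injectivity, so <g v, g u> < 1 for
   these unit vectors; the strict inequality persists for [y] near [g u], uniformly in [v]. *)
have Bnear : \forall y \near g u, B `<=` P y.
  have /compact_near_coveringP cov := Bc; apply: (cov _ (nbhs (g u)) P) => v uv.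
  have vu : 0 < dot (g u) (g u) - dot (g v) (g u).
    have : 0 < dot (g u - g v) (g u - g v).
      rewrite lt_def dot_ge0 dot_eq0 subr_eq0 andbT; apply/negP => /eqP E.
      have : u = v.
        apply: inj E; rewrite -ball_normE /= ?subrr ?normr0//.
        by rewrite uv.
      move=> E'; move: uv; rewrite /B /= -E' subrr normr0 => r00.
      by move: r0; rewrite -r00 ltxx.
    rewrite dotBl !dotBr !gg (dotC (g v)); lra.
  have c : dot (g u) p.2 - dot (g p.1) p.2 @[p --> (v, g u)] --> dot (g u) (g u) - dot (g v) (g u).
    have c2 : p.2 @[p --> (v, g u)] --> g u by exact: cvg_snd.
    have c1 : g p.1 @[p --> (v, g u)] --> g v by apply: (cvg_comp _ g cvg_fst); exact: cg.
    by apply: cvgB; [apply: (cvg_dot _ c2); exact: cvg_cst|exact: (cvg_dot c1 c2)].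
  have h : \forall p \near (v, g u), P p.2 p.1.
    by apply: filterS (cvgr_gt _ c _ vu) => p; rewrite /P subr_gt0.
  exact: h.
have Pnear : \forall y \near g u, 0 < dot (g u) y.
  have c : dot (g u) y @[y --> g u] --> dot (g u) (g u).
    have c1 : y @[y --> g u] --> g u by exact: cvg_id.
    by apply: (cvg_dot _ c1); exact: cvg_cst.
  by apply: (cvgr_gt _ c); rewrite gg ltr01.
have [d d0 dP] := near_norm (filterI Bnear Pnear).
exists d => // y yy /dP[By Py].
have dh v : differentiable (fun v => dot (g v) y) v.
  by apply: differentiable_dotv; [exact: dG|exact: differentiable_cst].
have Ku : K u by rewrite /K /= subrr normr0 ltW.
have [c cK cmax] : exists2 c, c \in K & forall t, t \in K -> dot (g t) y <= dot (g c) y.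
  apply: EVT_max_rV => //; first by exists u.
  by apply: continuous_subspaceT => v; apply: differentiable_continuous; exact: dh.
have uc := cmax u (mem_set Ku); move: cK; rewrite inE /K /= => cK.
have cr : `|u - c| < r.
  rewrite lt_neqAle cK andbT; apply/eqP => cB.
  by have := By c cB; rewrite /P ltNge uc.
exists c; first exact: lt_trans cr re.
apply: (left_gauss_critical (sxb b) (f1 b) (detg b) (Kpos b) yy); first exact: lt_le_trans uc.
move=> i; have rc : 0 < r - `|u - c| by rewrite subr_gt0.
have := @pd_local_max _ (fun v => dot (g v) y) i c _ dh rc _.
rewrite pd_dot; [|exact: dG|exact: differentiable_cst].
rewrite pd_cst (dotC _ 0) dot0l addr0; apply => v cv; apply: cmax.
rewrite inE /K /=; apply: le_trans (ler_distD c _ _) _.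
by rewrite -lerBrDl ltW.
Qed.

Let surface_gauss_open z (e : R) : 0 < e -> exists2 d, 0 < d &
  forall y, dot y y = 1 -> `|surface_gauss z - y| < d ->
  exists2 z', dist z z' < e & surface_gauss z' = y.
Proof.
have [b [u [-> _]]] := stereo_surj z => e0.
have [r r0 rP] := stereo_near b u e0.
have [d d0 dP] := left_gauss_open b u r0.
exists d => // y yy; rewrite surface_gaussE => /(dP _ yy)[v uv gv].
by exists (stereo b v); [exact: rP|rewrite surface_gaussE].
Qed.

Lemma surface_gauss_north : exists2 z, surface_gauss z = north R &
  forall z', surface_gauss z' = north R -> z' = z.
Proof.
exact: (covering_north surface_gauss_unit surface_gauss_cont surface_gauss_inj
  surface_gauss_open).
Qed.

End GaussMapOfSurface.

(** * The retraction *)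

Section Retraction.
Variable R : realType.
Local Notation S2 := (sphere R 2).
Local Notation S3 := (sphere R 3).

Let gaussE (x : curved_immersion R) b u :
  surface_gauss (set_val x) (stereo b u) = left_gauss (in_chart (set_val x) b) u.
Proof. exact: (surface_gaussE (valP x)). Qed.

Definition gauss_preimage (x : curved_immersion R) : S2 :=
  xget (stereo false 0) [set z | surface_gauss (set_val x) z = north R].

Lemma gauss_preimageP x : surface_gauss (set_val x) (gauss_preimage x) = north R.
Proof.
have [z xz _] := surface_gauss_north (valP x).
have : [set z | surface_gauss (set_val x) z = north R] z by [].
exact: xgetI.
Qed.

Lemma gauss_preimage_unique x z :
  surface_gauss (set_val x) z = north R -> z = gauss_preimage x.
Proof.
have [z' _ uz'] := surface_gauss_north (valP x).
by move=> /uz' ->; rewrite (uz' _ (gauss_preimageP x)).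
Qed.

(* The unit normal of x at gauss_preimage x, where its coordinates are north. *)
Definition retract (x : curved_immersion R) : S3 :=
  great_sphere_map (set_val x (gauss_preimage x)) (stereo false 0).

Lemma curved_smooth (x : curved_immersion R) : smooth_map (set_val x).
Proof. by have /set_mem[[]] := valP x. Qed.

Lemma retract_reparam (x y : curved_immersion R) phi : oriented_diffeo phi ->
  set_val y = set_val x \o phi -> retract y = retract x.
Proof.
move=> [[psi [phiK psiK sphi _]] pos] yx.
suff E : gauss_preimage y = psi (gauss_preimage x) by rewrite /retract yx /= E psiK.
apply/esym/gauss_preimage_unique; rewrite -[RHS](gauss_preimageP x).
have [b' [u' [E' _]]] := stereo_surj (psi (gauss_preimage x)).
have [b [u [E _]]] := stereo_surj (gauss_preimage x).
rewrite E' E !gaussE yx.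
apply: (left_gauss_reparam (curved_smooth x) sphi); first exact: pos.
by rewrite -E' psiK E.
Qed.

(** In quaternions the surface is x = - p y and its normal is p. As y y = -1, p is - x (- y), whose
    frame coordinates are - y: the left Gauss map of [S_p] is the antipodal map. *)
Lemma left_gauss_great_sphere (p : S3) b u :
  left_gauss (in_chart (great_sphere_map p) b) u = - stereo_pt b u.
Proof.
have pp : dot (set_val p) (set_val p) = 1 := sphere_unit p.
pose f := in_chart (great_sphere_map p) b; set y := stereo_pt b u.
have pE i : pd i f u = pd i (stereo_pt b) u *m perp_frame (set_val p).
  rewrite (@pd_mulmx _ _ _ (stereo_pt b) (perp_frame (set_val p)) i u)//.
  by apply: rat_row_diff; exact: rat_row_stereo.
have aE i : left_form f i u = cross3 y (pd i (stereo_pt b) u).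
  by rewrite /left_form pE perp_frame_cross3 pp scale1r.
have yy : dot y y = 1 := sphere_unit (stereo b u).
have pos : 0 < dot y (cross3 (pd 0 (stereo_pt b) u) (pd 1 (stereo_pt b) u)).
  by have := stereo_oriented b u; rewrite !unlock.
have nE : left_normal f u = dot y (cross3 (pd 0 (stereo_pt b) u) (pd 1 (stereo_pt b) u)) *: - y.
  rewrite /left_normal !aE; move: (pd 0 _ _) (pd 1 _ _) => v w.
  by apply: row3P; rewrite !mxE /= !dot3E !mxE /=; ring.
have yy' : dot (- y) (- y) = 1 by rewrite dotNl dotC dotNl opprK.
move: pos nE; set k := dot y _ => pos nE; clearbody k y.
rewrite /left_gauss -/f nE dotZl dotZr yy' mulr1 -expr2 sqrtr_sqr.
by rewrite gtr0_norm// scalerA mulVf ?scale1r// gt_eqF.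
Qed.

Lemma retract_great_sphere (p : S3) : retract (great_sphere_immersion p) = p.
Proof.
set x := great_sphere_immersion p; set z := gauss_preimage x.
have [b [u [E _]]] := stereo_surj z.
have zn : - set_val z = north R.
  rewrite -(gauss_preimageP x) -/z E gaussE.
  by rewrite left_gauss_great_sphere.
apply: val_inj.
have -> : val (retract x) = north R *m perp_frame (set_val z *m perp_frame (set_val p)) by [].
rewrite -zn.
(* The quaternion identity z z = - |z|^2, multiplied by [p] on the left. *)
transitivity (dot (set_val z) (set_val z) *: set_val p).
  move: (set_val z) (set_val p) => q r; rewrite dot3E.
  by apply: row4P; rewrite !mxE sum3E !mxE /= !sum3E !mxE /=; ring.
by rewrite (sphere_unit z) scale1r.
Qed.

(** Evaluation is jointly continuous for the compact-open topology as the plane is locally compact: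
    a jet close to [h0] still maps the compact neighbourhood [K] of [u0] into the open set [O]. *)
Lemma jet_continuous w b (x0 : curved_immersion R) u0 :
  partials w (in_chart (set_val p.1) b) p.2 @[p --> (x0, u0)] -->
  partials w (in_chart (set_val x0) b) u0.
Proof.
set h0 := partials w (in_chart (set_val x0) b).
have ch : {for u0, continuous h0}.
  by apply: differentiable_continuous; exact: (curved_smooth x0 b w).
apply/cvgrPdist_lt => e e0.
have [d d0 dP] := near_norm ((cvgrPdist_lt _ _).1 ch e e0).
pose K := [set u : 'rV[R]_2 | `|u0 - u| <= d / 2].
pose O := [set v : 'rV[R]_4 | `|h0 u0 - v| < e].
have Kc : compact K by exact: norm_ball_compact.
have Oo : open O.
  rewrite (_ : O = ball (h0 u0) e); first exact: ball_open.
  by apply/seteqP; split => v; rewrite /O -ball_normE.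
have hKO : h0 @` K `<=` O.
  move=> _ [u uK <-]; apply: dP; apply: le_lt_trans uK _.
  by rewrite ltr_pdivrMr// ltr_pMr// ltr1n.
have cj : continuous (fun x : curved_immersion R =>
    (partials w (in_chart (set_val x) b) : {compact-open, 'rV[R]_2 -> 'rV[R]_4})).
  move=> x; apply: (@continuous_comp _ _ _ (@jets R) (fun f => f (b, w))).
    exact: initial_continuous.
  exact: (@proj_continuous _
    (fun _ : bool * seq 'I_2 => {compact-open, 'rV[R]_2 -> 'rV[R]_4}) (b, w)).
have nx : nbhs x0 [set x | partials w (in_chart (set_val x) b) @` K `<=` O].
  exact: (cj x0 _ (open_nbhs_nbhs (conj (compact_open_open Kc Oo) hKO))).
have nK : nbhs u0 K.
  apply: (filterS _ (nbhsx_ballx u0 (d / 2) _)); last by rewrite divr_gt0.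
  by move=> u; rewrite -ball_normE /K /= => /ltW.
exists ([set x | partials w (in_chart (set_val x) b) @` K `<=` O], K) => //.
by move=> [x u] /= [xKO uK]; apply: (xKO _); exists u.
Qed.

Lemma frame_continuous b (x0 : curved_immersion R) u0 :
  in_chart (set_val p.1) b p.2 @[p --> (x0, u0)] --> in_chart (set_val x0) b u0.
Proof. exact: (@jet_continuous [::] b x0 u0). Qed.

Lemma left_gauss_jointly_continuous b (x0 : curved_immersion R) u0 :
  left_gauss (in_chart (set_val p.1) b) p.2 @[p --> (x0, u0)] -->
  left_gauss (in_chart (set_val x0) b) u0.
Proof.
have cf i : left_form (in_chart (set_val p.1) b) i p.2 @[p --> (x0, u0)] -->
    left_form (in_chart (set_val x0) b) i u0.
  rewrite /left_form unlock; apply: cvg_mulmx_perp; last exact: frame_continuous.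
  exact: (@jet_continuous [:: i] b x0 u0).
have cn : left_normal (in_chart (set_val p.1) b) p.2 @[p --> (x0, u0)] -->
    left_normal (in_chart (set_val x0) b) u0 by exact: cvg_cross3.
have n0 : dot (left_normal (in_chart (set_val x0) b) u0)
    (left_normal (in_chart (set_val x0) b) u0) != 0.
  rewrite dot_left_normal; last by move=> v; exact: in_chart_unit.
    by apply: immersion_det; have /set_mem[] := valP x0.
  exact: curved_smooth.
apply: cvgZ => //; apply: cvgV; last first.
  apply: (cvg_comp _ Num.sqrt (cvg_dot cn cn)); exact: sqrt_continuous.
by rewrite sqrtr_eq0 -ltNge lt_def n0 dot_ge0.
Qed.

(** [P b x u] says that if [u] is the chart coordinate of the sought point then the value of
    [retract] lies in [W]. It holds near each (x0, u0), and compactness of the disc gives one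
    neighbourhood of [x0] valid for all [u]. *)
Lemma retract_continuous : continuous retract.
Proof.
move=> x0 W rW.
pose P b (x : curved_immersion R) u := left_gauss (in_chart (set_val x) b) u = north R ->
  W (great_sphere_map (set_val x (stereo b u)) (stereo false 0)).
pose D := [set u : 'rV[R]_2 | dot u u <= 1].
have cD : compact D.
  apply: (subclosed_compact _ (@norm_ball_compact R 1 0 2)).
    have -> : D = (fun u => dot u u) @^-1` [set t | t <= 1] by [].
    apply: closed_comp; last exact: closed_le.
    by move=> u _; have c : v @[v --> u] --> u by [exact: cvg_id]; exact: (cvg_dot c c).
  move=> u /= uu; rewrite sub0r normrN; apply: ltW; apply: norm_lt_dot => //.
  by apply: le_lt_trans uu _; rewrite expr2; lra.
have swap b (u0 : 'rV[R]_2) : (\forall p \near (x0, u0), P b p.1 p.2) ->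
    \forall u \near u0 & x \near x0, P b x u.
  move=> [[A B] /= [nA nB] AB]; exists (B, A) => // -[u x] [Bu Ax].
  exact: (AB (x, u) (conj Ax Bu)).
have near b : \forall x \near x0, D `<=` P b x.
  have /compact_near_coveringP cov := cD; apply: (cov _ (nbhs x0) (P b)) => u0 _.
  (* If [u0] solves the equation for [x0], the conclusion of [P] holds nearby by continuity of [q];
     if not, its premise fails nearby. *)
  have [g0|g0] := pselect (left_gauss (in_chart (set_val x0) b) u0 = north R).
    pose q (p : curved_immersion R * 'rV[R]_2) : S3 :=
      great_sphere_map (set_val p.1 (stereo b p.2)) (stereo false 0).
    have cq : continuous q.
      apply: continuous_comp_initial => -[x1 u1].
      pose M : 'M[R]_4 := \matrix_i (north R *m perp_frame (delta_mx 0 i)).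
      have E p : (set_val \o q) p = in_chart (set_val p.1) b p.2 *m M.
        transitivity (north R *m perp_frame (in_chart (set_val p.1) b p.2)) => //.
        rewrite [RHS]mulmx_sum_row {1}perp_frame_lin mulmx_sumr.
        by apply: eq_bigr => i _; rewrite rowK scalemxAr.
      rewrite (funext E).
      exact: cvg_mulmx_cst (@frame_continuous b x1 u1).
    have Wq : nbhs (q (x0, u0)) W.
      have <- : retract x0 = q (x0, u0).
        by rewrite /q /= (@gauss_preimage_unique x0 (stereo b u0))// gaussE.
      exact: rW.
    have hW : \forall p \near (x0, u0), W (q p) := cq (x0, u0) _ Wq.
    have h : \forall p \near (x0, u0), P b p.1 p.2.
      by apply: filterS hW => p Wp _.
    exact: swap h.
  have n0 : 0 < dot (left_gauss (in_chart (set_val x0) b) u0 - north R)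
      (left_gauss (in_chart (set_val x0) b) u0 - north R).
    by rewrite lt_def dot_ge0 dot_eq0 subr_eq0 andbT; apply/eqP.
  have cg := @left_gauss_jointly_continuous b x0 u0.
  pose dif (p : curved_immersion R * 'rV[R]_2) : 'rV[R]_3 :=
    left_gauss (in_chart (set_val p.1) b) p.2 - north R.
  have cd : dif p @[p --> (x0, u0)] --> dif (x0, u0).
    exact: (cvgB cg (cvg_cst (north R))).
  have hd : \forall p \near (x0, u0), 0 < dot (dif p) (dif p).
    have cdd : dot (dif p) (dif p) @[p --> (x0, u0)] --> dot (dif (x0, u0)) (dif (x0, u0)).
      exact: cvg_dot.
    exact: (cvgr_gt _ cdd _ n0).
  have h : \forall p \near (x0, u0), P b p.1 p.2.
    apply: filterS hd => p; rewrite /dif => gp.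
    by rewrite /P => E; move: gp; rewrite E subrr dot0l ltxx.
  exact: swap h.
apply: filterS (filterI (near false) (near true)) => x [xf xt].
have [b [u [E uD]]] := stereo_surj (gauss_preimage x).
have gu : left_gauss (in_chart (set_val x) b) u = north R.
  by rewrite -gaussE -E gauss_preimageP.
rewrite /= /retract E; case: b {E} gu => gu; [exact: (xt u uD)|exact: (xf u uD)].
Qed.

End Retraction.

Theorem theorem3 (R : realType) :
  exists r : oriented_surface R -> sphere R 3,
    continuous r /\ forall p : sphere R 3, r (great_sphere p) = p.
Proof.
have inv (x y : curved_immersion R) :
    (\pi_(oriented_surface R) x = \pi_(oriented_surface R) y)%qT -> retract x = retract y.
  move=> E.
  have : reparam_orbit x y.
    rewrite !unlock in E.
    (* Equal classes are equal orbits as sets, and [y] belongs to its own orbit through the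
       identity. *)
    have -> : reparam_orbit x = reparam_orbit y.
      by exact: (congr1 (fun C : orbit_space R => val C) E).
    exists id => //; split; last first.
      by move=> b u /=; rewrite frame_det3; exact: stereo_oriented.
    exists id; split=> //; move=> b; apply: rat_row_smooth; exact: rat_row_stereo.
  by move=> [phi ophi yx]; rewrite (retract_reparam ophi yx).
exists (@retract R \o repr); split.
  apply: repr_comp_continuous; first exact: retract_continuous.
  by move=> x y /eqP xy; apply/eqP; exact: inv.
move=> p; rewrite -[RHS]retract_great_sphere; apply: inv.
exact: reprK.
Qed.
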